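(* In a finite dynamic game as described in the context, if $K=(K^i)_{i\in\mathcal{I}}$ is mutually sufficient information, then there exists at least one $K$-based sequential equilibrium, i.e. a sequential equilibrium $(\rho,Q)$ in which $\rho$ is a $K$-based strategy profile.
   Context: Game model: finite set of players $\mathcal{I}$, times $\mathcal{T}=\{1,\dots,T\}$. At time $t$ each player $i$ takes action $U_t^i\in\mathcal{U}_t^i$, obtains reward $R_t^i\in[-1,1]$ and learns new information $Z_t^i\in\mathcal{Z}_t^i$. There is a state $X_t\in\mathcal{X}_t$ with $(X_{t+1},Z_t,R_t)=f_t(X_t,U_t,W_t)$ for fixed functions $f_t$. Primitive random variables $(X_1,H_1)$ (with $H_1=(H_1^i)_i$ initial information) and $W_1,\dots,W_T$ are mutually independent with commonly known distributions. All sets $\mathcal{X}_t,\mathcal{U}_t,\mathcal{Z}_t,\mathcal{W}_t,\mathcal{H}_1$ are finite. Perfect recall: $H_t^i=(H_1^i,Z_{1:t-1}^i)\in\mathcal{H}_t^i$, and $U_t^i$ is a component of $Z_t^i$. Behavioral strategy $g_t^i:\mathcal{H}_t^i\to\Delta(\mathcal{U}_t^i)$; payoff $J^i(g)=\mathbb{E}^g[\sum_t R_t^i]$. A realization is admissible under a partial profile if it has positive probability under some completion. Sequential equilibrium (SE): for a profile $g$ and functions $Q=(Q_t^i)$, $Q_t^i:\mathcal{H}_t^i\times\mathcal{U}_t^i\to\mathbb{R}$: $g$ is sequentially rational under $Q$ if $\mathrm{supp}(g_t^i(h_t^i))\subseteq\arg\max_{u}Q_t^i(h_t^i,u)$ for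 all $i,t,h_t^i$; $Q$ is fully consistent with $g$ if there is a sequence $(g^{(n)},Q^{(n)})\to(g,Q)$ with each $g^{(n)}$ fully mixed (every action has positive probability at every history) and $Q_\tau^{(n),i}(h_\tau^i,u_\tau^i)=\mathbb{E}^{g^{(n)}}[\sum_{t=\tau}^T R_t^i\mid h_\tau^i,u_\tau^i]$ for all $i,\tau,h_\tau^i,u_\tau^i$. $(g,Q)$ is an SE if both hold. Compression: $K_1^i=\iota_1^i(H_1^i)$, $K_t^i=\iota_t^i(K_{t-1}^i,Z_{t-1}^i)$ for fixed maps, finite value sets $\mathcal{K}_t^i$; $k_t^i$ is the compression of $h_t^i$; a $K^i$-based strategy has $\rho_t^i:\mathcal{K}_t^i\to\Delta(\mathcal{U}_t^i)$. Information state: given $g^{-i}$, $K^i$ is an information state under $g^{-i}$ if there exist $P_t^{i,g^{-i}}:\mathcal{K}_t^i\times\mathcal{U}_t^i\to\Delta(\mathcal{K}_{t+1}^i)$, $r_t^{i,g^{-i}}:\mathcal{K}_t^i\times\mathcal{U}_t^i\to[-1,1]$ with $\Pr^{g^i,g^{-i}}(k_{t+1}^i\mid h_t^i,u_t^i)=P_t^{i,g^{-i}}(k_{t+1}^i\mid k_t^i,u_t^i)$ ($t<T$) and $\mathbb{E}^{g^i,g^{-i}}[R_t^i\mid h_t^i,u_t^i]=r_t^{i,g^{-i}}(k_t^i,u_t^i)$ for all $g^i$ and all $(h_t^i,u_t^i)$ admissible under $(g^i,g^{-i})$. $K$ is mutually sufficient information (MSI) if for every $i$ and every profile $\rho^{-i}$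 of $K^j$-based strategies of players $j\neq i$, $K^i$ is an information state under $\rho^{-i}$. *)

(* Defs.v *)
From HB Require Import structures.
From mathcomp Require Import all_boot all_order all_algebra.
From mathcomp Require Import classical_sets filter reals topology normedtype.
Set Implicit Arguments. Unset Strict Implicit. Unset Printing Implicit Defensive.
Import Order.TTheory GRing.Theory Num.Theory.
Import numFieldNormedType.Exports.
Local Open Scope classical_set_scope.
Local Open Scope ring_scope.

(* Times are 0-based: the paper's time t \in {1..T} is our t-1 \in {0..T-1}.
   All families are indexed by every nat; values at times >= T are junk and
   never constrained/used. *)

Definition is_dist (R : numDomainType) (A : finType) (p : A -> R) : Prop :=
  (forall a, 0 <= p a) /\ \sum_(a : A) p a = 1.

Unset Implicit Arguments.
Record game (R : realType) := Game {
  horizon : nat;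
  player : finType;
  Xs : nat -> finType;
  Ws : nat -> finType;
  Us : nat -> player -> finType;
  Zs : nat -> player -> finType;
  H1s : player -> finType;
  (* (X_{t+1}, Z_t, R_t) = f_t(X_t, U_t, W_t), split into its three components *)
  fX : forall t, Xs t -> {dffun forall i, Us t i} -> Ws t -> Xs t.+1;
  fZ : forall t, Xs t -> {dffun forall i, Us t i} -> Ws t -> {dffun forall i, Zs t i};
  fR : forall t, Xs t -> {dffun forall i, Us t i} -> Ws t -> player -> R;
  (* U_t^i is a component of Z_t^i: projection act_t^i *)
  act : forall t i, Zs t i -> Us t i;
  (* distributions of the independent primitive random variables (X_1,H_1), W_t *)
  P0 : Xs 0 * {dffun forall i, H1s i} -> R;
  PW : forall t, Ws t -> R;
  P0_dist : is_dist P0;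
  PW_dist : forall t, (t < horizon)%N -> is_dist (PW t);
  fR_bound : forall t x u w i, (t < horizon)%N -> -1 <= fR t x u w i <= 1;
  act_component : forall t x u w i, (t < horizon)%N -> act t i (fZ t x u w i) = u i
}.
Set Implicit Arguments.
Arguments horizon {R}. Arguments player {R}. Arguments Xs {R}. Arguments Ws {R}.
Arguments Us {R}. Arguments Zs {R}. Arguments H1s {R}.
Arguments fX {R} _ {t}. Arguments fZ {R} _ {t}. Arguments fR {R} _ {t}.
Arguments act {R} _ {t i}. Arguments P0 {R} _. Arguments PW {R} _ {t}.

Section Game.
Variables (R : realType) (G : game R).
Local Notation T := (horizon G).
Local Notation I := (player G).
Local Notation X := (Xs G).
Local Notation W := (Ws G).
Local Notation U := (Us G).
Local Notation Z := (Zs G).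
Local Notation H1 := (H1s G).

Fixpoint Hist (i : I) (t : nat) : finType :=
  match t with
  | 0 => H1 i
  | t'.+1 => (Hist i t' * Z t' i)%type
  end.

(* Realizations of primitive randomness and actions up to time t:
   ((X_1,H_1), (W_1,U_1), ..., (W_t,U_t)) *)
Fixpoint Traj (t : nat) : finType :=
  match t with
  | 0 => (X 0 * {dffun forall i, H1 i})%type
  | t'.+1 => (Traj t' * W t' * {dffun forall i, U t' i})%type
  end.

Fixpoint state (t : nat) : Traj t -> X t :=
  match t return Traj t -> X t with
  | 0 => fun om => om.1
  | t'.+1 => fun om => fX G (state om.1.1) om.2 om.1.2
  end.

Fixpoint hist (i : I) (t : nat) : Traj t -> Hist i t :=
  match t return Traj t -> Hist i t with
  | 0 => fun om => om.2 i
  | t'.+1 => fun om => (hist i om.1.1, fZ G (state om.1.1) om.2 om.1.2 i)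
  end.

Definition lastrew (i : I) (t : nat) : Traj t -> R :=
  match t return Traj t -> R with
  | 0 => fun _ => 0
  | t'.+1 => fun om => fR G (state om.1.1) om.2 om.1.2 i
  end.

Definition profile := forall (t : nat) (i : I), Hist i t -> U t i -> R.

Definition valid_profile (g : profile) : Prop :=
  forall t, (t < T)%N -> forall i (h : Hist i t), is_dist (g t i h).

Definition fully_mixed (g : profile) : Prop :=
  valid_profile g /\
  forall t, (t < T)%N -> forall i (h : Hist i t) (u : U t i), 0 < g t i h u.

Definition fwd (g : profile) (t : nat) (m : Traj t -> R) : Traj t.+1 -> R :=
  fun om => m om.1.1 * PW G om.1.2 * \prod_(j : I) g t j (hist j om.1.1) (om.2 j).

Unset Implicit Arguments.
Fixpoint fwdk (g : profile) (tau : nat) (k : nat) (m : Traj tau -> R)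
  : Traj (Nat.add k tau) -> R :=
  match k return Traj (Nat.add k tau) -> R with
  | 0 => m
  | k'.+1 => @fwd g _ (fwdk g tau k' m)
  end.
Set Implicit Arguments.

Fixpoint prob (g : profile) (t : nat) : Traj t -> R :=
  match t return Traj t -> R with
  | 0 => P0 G
  | t'.+1 => fwd g (@prob g t')
  end.

Definition prob_on (g : profile) (i : I) (t : nat) (h : Hist i t) (u : U t i)
  : Traj t.+1 -> R :=
  fun om => prob g om * ((hist i om.1.1 == h) && (om.2 i == u))%:R.

Definition Pr_hu (g : profile) i t (h : Hist i t) (u : U t i) : R :=
  \sum_(om : Traj t.+1) prob_on g h u om.

(* E^g[ R_s^i 1{h_t^i,u_t^i} ] for s = t + k *)
Definition ER_on (g : profile) i t (h : Hist i t) (u : U t i) (k : nat) : R :=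
  \sum_(om : Traj (Nat.add k t.+1)) fwdk g t.+1 k (prob_on g h u) om * lastrew i om.

Definition Qto_go (g : profile) i t (h : Hist i t) (u : U t i) : R :=
  (\sum_(k < T - t) ER_on g h u k) / Pr_hu g h u.

Definition ER_cond (g : profile) i t (h : Hist i t) (u : U t i) : R :=
  ER_on g h u 0 / Pr_hu g h u.

Definition Qfun := forall (t : nat) (i : I), Hist i t -> U t i -> R.

Definition seq_rational (g : profile) (Q : Qfun) : Prop :=
  forall t, (t < T)%N -> forall i (h : Hist i t) (u : U t i),
    0 < g t i h u -> forall u' : U t i, Q t i h u' <= Q t i h u.

Definition fully_consistent (g : profile) (Q : Qfun) : Prop :=
  exists (gn : nat -> profile) (Qn : nat -> Qfun),
    (forall n, fully_mixed (gn n)) /\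
    (forall n t, (t < T)%N -> forall i (h : Hist i t) (u : U t i),
        0 < Pr_hu (gn n) h u -> Qn n t i h u = Qto_go (gn n) h u) /\
    (forall t, (t < T)%N -> forall i (h : Hist i t) (u : U t i),
        (fun n => gn n t i h u) @ \oo --> g t i h u) /\
    (forall t, (t < T)%N -> forall i (h : Hist i t) (u : U t i),
        (fun n => Qn n t i h u) @ \oo --> Q t i h u).

Definition sequential_equilibrium (g : profile) (Q : Qfun) : Prop :=
  valid_profile g /\ seq_rational g Q /\ fully_consistent g Q.

Record compression := Compression {
  Ks : nat -> I -> finType;
  iota1 : forall i, H1 i -> Ks 0 i;
  iotaS : forall t i, Ks t i -> Z t i -> Ks t.+1 i
}.

Fixpoint comp (C : compression) (i : I) (t : nat) : Hist i t -> Ks C t i :=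
  match t return Hist i t -> Ks C t i with
  | 0 => fun h => iota1 C h
  | t'.+1 => fun h => iotaS (comp C h.1) h.2
  end.

Definition Kprofile (C : compression) :=
  forall (t : nat) (i : I), Ks C t i -> U t i -> R.

Definition valid_Kprofile C (rho : Kprofile C) : Prop :=
  forall t, (t < T)%N -> forall i (k : Ks C t i), is_dist (rho t i k).

Definition Kbased C (rho : Kprofile C) : profile :=
  fun t i h u => rho t i (comp C h) u.

(* K^i is an information state under g^{-i} (g^{-i} is the part of the
   profile g off player i). *)
Definition info_state C (i : I) (g : profile) : Prop :=
  exists (P : forall t, Ks C t i -> U t i -> Ks C t.+1 i -> R)
         (r : forall t, Ks C t i -> U t i -> R),
    (forall t, (t.+1 < T)%N -> forall k u, is_dist (P t k u)) /\
    (forall t, (t < T)%N -> forall k u, -1 <= r t k u <= 1) /\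
    forall g' : profile, valid_profile g' ->
      (forall t j, j != i -> g' t j = g t j) ->
      forall t, (t < T)%N -> forall (h : Hist i t) (u : U t i),
        0 < Pr_hu g' h u ->
        ((t.+1 < T)%N -> forall k' : Ks C t.+1 i,
           (\sum_(om : Traj t.+1)
               prob_on g' h u om * (comp C (hist i om) == k')%:R) / Pr_hu g' h u
           = P t (comp C h) u k') /\
        ER_cond g' h u = r t (comp C h) u.

Definition MSI (C : compression) : Prop :=
  forall (i : I) (rho : Kprofile C), valid_Kprofile rho ->
    info_state C i (Kbased rho).

End Game.

(* Main.v *)
(* A perturbed game is solved by a logit (quantal response) fixed point, and
   the equilibrium is a limit of such fixed points.

   MSI, applied to a fully mixed K-based profile against itself, shows by
   backward induction that the continuation value Q(h, u) of a reachable
   history depends on h only through its compression.  So the map sending a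
   K-based profile to the logit response (with parameter n) to its own Q-values
   is well defined, and after an eps-perturbation towards full mixing it is
   continuous; Brouwer's theorem gives a fully mixed K-based profile rho_n with
   rho_n(u | k) <= exp (n (Q_n(h, u) - Q_n(h, u'))) + 1 / (n + 1) for every
   reachable h compressed to k with Q_n(h, u') > Q_n(h, u).  Along a convergent
   subsequence of (rho_n, Q_n) suboptimal actions lose all their weight, so the
   limit is sequentially rational, and it is consistent by construction.

   Brouwer's theorem on a simplex follows from Scarf's combinatorial lemma on
   dominant sets, which replaces triangulations: grid points are compared by
   their coordinates, and a parity argument on almost fully labelled "doors"
   between "rooms" yields a fully labelled dominant pair. *)
Require Import Defs.
From HB Require Import structures.
From mathcomp Require Import all_boot all_order all_algebra.
From mathcomp Require Import boolp zify.
Set Implicit Arguments. Unset Strict Implicit. Unset Printing Implicit Defensive.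

(** * Scarf's lemma *)

Section Scarf.
Variables (I T : finType) (v : I -> T -> nat).

(** Scarf's dominance: no point lies strictly above the minimum of [D] in every coordinate of [C].
    The points violating this form [exceeding]. *)
Definition dominant (D : {set T}) (C : {set I}) :=
  [forall t, [exists i in C, [forall d in D, v i t <= v i d]]].

Definition exceeding (D : {set T}) (C : {set I}) : {set T} :=
  [set t | [forall i in C, [exists d in D, v i d < v i t]]].

Lemma dominantP (D : {set T}) (C : {set I}) :
  reflect (forall t, exists2 i, i \in C & forall d, d \in D -> v i t <= v i d)
          (dominant D C).
Proof.
apply: (iffP forallP) => H t.
  have /exists_inP[i iC /forall_inP Hi] := H t.
  by exists i.
have [i iC Hi] := H t.
by apply/exists_inP; exists i => //; apply/forall_inP.
Qed.

Lemma exceedingP (D : {set T}) (C : {set I}) t :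
  reflect (forall i, i \in C -> exists2 d, d \in D & v i d < v i t)
          (t \in exceeding D C).
Proof.
rewrite inE; apply: (iffP forall_inP) => H i iC.
  by have /exists_inP[d dD Hd] := H i iC; exists d.
by have [d dD Hd] := H i iC; apply/exists_inP; exists d.
Qed.

Lemma dominant_exceeding (D : {set T}) (C : {set I}) :
  dominant D C = (exceeding D C == set0).
Proof.
apply/dominantP/eqP => [H|H t].
  apply/setP => t; rewrite [RHS]inE; apply/exceedingP => Ht.
  have [i iC Hi] := H t; have [d dD] := Ht i iC.
  by rewrite ltnNge Hi.
have /negP : t \notin exceeding D C by rewrite H inE.
rewrite inE => /negP/forall_inPn[i iC /exists_inPn Hi].
by exists i => // d dD; rewrite leqNgt Hi.
Qed.

Lemma dominantW (D D' : {set T}) (C C' : {set I}) :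
  D' \subset D -> C \subset C' -> dominant D C -> dominant D' C'.
Proof.
move=> /subsetP sD /subsetP sC /dominantP H; apply/dominantP => t.
have [i iC Hi] := H t; exists i; first exact: sC.
by move=> d /sD; apply: Hi.
Qed.

Hypothesis v_inj : forall i, injective (v i).

(** A room has as many points as coordinates. The doors used below have one coordinate more, so a
    room arises from a door by adding a point or dropping a coordinate. *)
Definition room (r : {set T} * {set I}) := dominant r.1 r.2 && (#|r.1| == #|r.2|).

Definition incident (q r : {set T} * {set I}) :=
  (q.1 \subset r.1) && (r.2 \subset q.2).

(** Writing the room as [(D', C')], the chain [#|D| <= #|D'| = #|C'| <= #|C| = #|D|.+1] makes
    exactly one of the two inclusions strict, by one element. *)
Lemma incident_room_cases (D : {set T}) (C : {set I}) r : #|C| = #|D|.+1 ->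
  room r -> incident (D, C) r ->
  (exists2 k, k \in C & r = (D, C :\ k)) \/
  (exists2 t, t \notin D & r = (t |: D, C)).
Proof.
case: r => D' C' cardC; rewrite /room /incident /= => /andP[_ /eqP cardr] /andP[sD sC].
have := subset_leq_card sD; have := subset_leq_card sC => leC leD.
have [eqDD'|neDD'] := eqVneq D D'.
  subst D'; left.
  have /cards1P[k Ek] : #|C :\: C'| == 1.
    by rewrite cardsD (setIidPr sC) cardC -cardr subSnn.
  have kC : k \in C :\: C' by rewrite Ek set11.
  exists k; first by move: kC; rewrite inE => /andP[].
  by rewrite -Ek setDDr setDv set0U (setIidPr sC).
have ltD : #|D| < #|D'| by apply: proper_card; rewrite properEneq neDD'.
have EC : C' = C by apply/eqP; rewrite eqEcard sC; lia.
right; subst C'.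
have /cards1P[t Et] : #|D' :\: D| == 1.
  by rewrite cardsD (setIidPr sD); apply/eqP; lia.
have tD : t \in D' :\: D by rewrite Et set11.
exists t; first by move: tD; rewrite inE => /andP[].
by rewrite -(setID D' D) (setIidPr sD) Et setUC.
Qed.

(** * The two rooms of an inner door *)

Section InnerDoor.
Variables (D : {set T}) (C : {set I}) (d0 : T).
Hypotheses (domDC : dominant D C) (d0D : d0 \in D) (cardDC : #|C| = #|D|.+1).

Let mu i := [arg min_(d < d0 in D) v i d].

Let muD i : mu i \in D.
Proof. by rewrite /mu; case: arg_minnP. Qed.

Let mu_min i d : d \in D -> v i (mu i) <= v i d.
Proof. by rewrite /mu; case: arg_minnP => // e eD He /He. Qed.

Let mu_uniq i d : d \in D -> (forall e, e \in D -> v i d <= v i e) -> mu i = d.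
Proof.
move=> dD Hd; apply: (@v_inj i); apply/eqP.
by rewrite eqn_leq mu_min //= Hd.
Qed.

Let exceedP k t : reflect (forall i, i \in C -> i != k -> v i (mu i) < v i t)
                          (t \in exceeding D (C :\ k)).
Proof.
apply: (iffP (exceedingP _ _ _)) => H i.
  move=> iC ik; have [|d dD Hd] := H i; first by rewrite !inE ik.
  by apply: leq_ltn_trans Hd; apply: mu_min.
by rewrite !inE => /andP[ik iC]; exists (mu i) => //; apply: H.
Qed.

(** Necessary for a room indexed by [k]: there [k] is dropped or serves the added point, so each
    point of [D] must be lowest in another coordinate. *)
Let removable k := D \subset mu @: (C :\ k).

Let removable_inj k : k \in C -> removable k -> {in C :\ k &, injective mu}.
Proof.
move=> kC rk; apply/imset_injP; rewrite eqn_leq leq_imset_card /=.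
apply: leq_trans (subset_leq_card rk).
by have := cardDC; rewrite (cardsD1 k C) kC add1n => -[->].
Qed.

(** If some point exceeds [D] on [C :\ k], dropping [k] would break dominance; the exceeding point
    that is highest in coordinate [k] is added instead. *)
Let next k :=
  if [pick t in exceeding D (C :\ k)] is Some t0 then
    ([arg max_(t > t0 in exceeding D (C :\ k)) v k t] |: D, C)
  else (D, C :\ k).

Let nextP k :
  (exceeding D (C :\ k) = set0 /\ next k = (D, C :\ k)) \/
  (exists t, [/\ t \in exceeding D (C :\ k),
     forall s, s \in exceeding D (C :\ k) -> v k s <= v k t &
     next k = (t |: D, C)]).
Proof.
rewrite /next; case: pickP => [t0 Ht0|H0].
  right; case: arg_maxnP => // t Ht Hm; exists t; split => //.
by left; split => //; apply/setP => t; rewrite [RHS]inE H0.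
Qed.

Let not_exceed_D k t : removable k -> t \in exceeding D (C :\ k) -> t \notin D.
Proof.
move=> rk /exceedP Ht; apply/negP => /(subsetP rk) /imsetP[l].
by rewrite !inE => /andP[lk lC] Et; have := Ht l lC lk; rewrite -Et ltnn.
Qed.

(** When [t] is added, an exceeding point is bounded at [k] by dominance of [(D, C)] and the choice
    of [t]. Any other point keeps its bound at some [l] other than [k], because [t] lies above the
    minimum there. *)
Let next_room k : k \in C -> removable k -> room (next k) && incident (D, C) (next k).
Proof.
move=> kC rk; rewrite /room /incident.
have cardk : #|D| = #|C :\ k| by have := cardDC; rewrite (cardsD1 k C) kC add1n => -[].
case: (nextP k) => [[E0 ->]|[t [Ht Hm ->]]] /=.
  by rewrite dominant_exceeding E0 cardk !eqxx subxx subsetDl.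
have tD := not_exceed_D rk Ht.
rewrite cardsU1 tD cardDC eqxx subsetUr subxx !andbT.
apply/dominantP => s.
have Hk : forall s, s \in exceeding D (C :\ k) -> forall d, d \in D -> v k s <= v k d.
  move=> {}s Hs; have [l lC Hl] := dominantP _ _ domDC s.
  have [<- //|lk] := eqVneq l k.
  by have := exceedP _ _ Hs l lC lk; rewrite ltnNge Hl.
have [Hs|] := boolP (s \in exceeding D (C :\ k)).
  exists k => // d; rewrite !inE => /orP[/eqP ->|]; first exact: Hm.
  exact: Hk.
rewrite inE => /forall_inPn[l]; rewrite !inE => /andP[lk lC] /exists_inPn Hl.
have {}Hl : v l s <= v l (mu l) by rewrite leqNgt Hl.
exists l => // d; rewrite !inE => /orP[/eqP ->|dD].
  by apply: leq_trans Hl _; apply: ltnW; apply: (exceedP _ _ Ht).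
by apply: leq_trans Hl _; apply: mu_min.
Qed.

(** For a room that adds [t], the index [k] is the coordinate where [t] is lowest. Dominance makes
    every point of [D] lowest elsewhere, and makes [t] the exceeding point highest in coordinate
    [k]. *)
Let room_next r : room r -> incident (D, C) r ->
  exists k, [/\ k \in C, removable k & r = next k].
Proof.
move=> rr inc; have := rr; rewrite /room => /andP[/dominantP domr _].
have [[k kC Er]|[t tD Er]] := incident_room_cases cardDC rr inc; subst r.
  exists k; split => //.
    apply/subsetP => d dD; have [l lC Hl] := domr d.
    by apply/imsetP; exists l => //; rewrite (mu_uniq dD).
  case: (nextP k) => [[E0 -> //]|[t [/exceedP Ht _ _]]].
  have [l] := domr t; rewrite !inE => /andP[lk lC] Hl.
  by have := Ht l lC lk; rewrite ltnNge Hl.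
have [k kC Hk] := domr t; rewrite /= in kC.
have minl d : d \in D -> exists2 l, l \in C :\ k & mu l = d /\ v l d < v l t.
  move=> dD; have [l lC Hl] := domr d.
  have dt : d != t by apply: contraNneq tD => <-.
  have dltt : v l d < v l t.
    rewrite ltn_neqAle Hl ?setU11 // andbT.
    by apply: contra_neq dt; apply: v_inj.
  exists l.
    rewrite !inE lC andbT; apply: contraTneq dltt => ->.
    by rewrite -leqNgt Hk // setU1r.
  split=> //; apply: mu_uniq => // e eD; apply: Hl.
  by rewrite setU1r.
have rk : removable k.
  apply/subsetP => d /minl[l lC [<- _]]; exact: imset_f.
have injk := removable_inj kC rk.
have tM : t \in exceeding D (C :\ k).
  apply/exceedP => l lC lk.
  (* Injectivity of [mu] on [C :\ k] identifies the coordinate found for [mu l] with [l]. *)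
  have [l' l'C [El' Hl']] := minl _ (muD l).
  have El : l' = l by apply: injk => //; rewrite !inE lk.
  by rewrite -El in Hl' *; rewrite El' in Hl' *.
have tmax s : s \in exceeding D (C :\ k) -> v k s <= v k t.
  move=> /exceedP Hs; have [l lC Hl] := domr s.
  have [<-|lk] := eqVneq l k; first by apply: Hl; rewrite setU11.
  by have := Hs l lC lk; rewrite ltnNge Hl // setU1r.
exists k; split => //.
case: (nextP k) => [[E0 _]|[t' [Ht' Hm ->]]]; first by rewrite E0 inE in tM.
congr (_ |: _, _); apply: (@v_inj k); apply/eqP.
by rewrite eqn_leq tmax // Hm.
Qed.

(** [mu] maps [C] onto [D], which has one element fewer, so exactly one pair [i], [j] collides.
    These two are the removable coordinates, and each yields one room. *)
Lemma inner_door_rooms :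
  #|[set r | room r && incident (D, C) r]| = 2.
Proof.
have mu_surj d : d \in D -> exists2 i, i \in C & mu i = d.
  move=> dD; have [i iC Hi] := dominantP _ _ domDC d.
  by exists i => //; apply: mu_uniq.
have : ~~ [forall i in C, forall j in C, (mu i == mu j) ==> (i == j)].
  apply/negP => /forall_inP H.
  have inj : {in C &, injective mu}.
    by move=> i j iC jC /eqP e; apply/eqP; move: (H i iC) => /forall_inP/(_ j jC)/implyP; apply.
  have : #|mu @: C| <= #|D|.
    by apply: subset_leq_card; apply/subsetP => _ /imsetP[i _ ->].
  by rewrite card_in_imset // cardDC ltnn.
case/forall_inPn => i iC /forall_inPn[j jC]; rewrite negb_imply => /andP[/eqP muij ij].
have ri : removable i.
  apply/subsetP => d /mu_surj[l lC <-]; apply/imsetP.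
  have [->|li] := eqVneq l i; first by exists j => //; rewrite !inE eq_sym ij.
  by exists l => //; rewrite !inE li.
have rj : removable j.
  apply/subsetP => d /mu_surj[l lC <-]; apply/imsetP.
  have [->|li] := eqVneq l j; first by exists i => //; rewrite !inE ij.
  by exists l => //; rewrite !inE li.
have ronly k : k \in C -> removable k -> (k == i) || (k == j).
  move=> kC rk; apply/norP => -[ki kj].
  have := removable_inj kC rk; move/(_ i j); rewrite !inE iC jC eq_sym ki eq_sym kj.
  by move=> /(_ isT isT muij) /eqP; apply/negP.
have -> : [set r | room r && incident (D, C) r] = [set next i; next j].
  apply/setP => r; rewrite in_set in_set2; apply/idP/idP.
    case/andP => rr /(room_next rr)[k [kC rk ->]].
    by case/orP: (ronly k kC rk) => /eqP ->; rewrite eqxx ?orbT.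
  by case/orP => /eqP ->; apply: next_room.
apply/eqP; rewrite cards2 eqSS eqb1; apply/eqP.
have addC t (E F : {set I}) : t \notin D -> (t |: D, E) <> (D, F).
  by move=> tD [E1 _]; move: tD; rewrite -E1 setU11.
case: (nextP i) => [[_ ->]|[t [Ht _ ->]]]; case: (nextP j) => [[_ ->]|[s [Hs _ ->]]].
- by case=> /setP /(_ i); rewrite !inE eqxx ij iC.
- by move=> /esym; apply: addC; apply: not_exceed_D rj Hs.
- by apply: addC; apply: not_exceed_D ri Ht.
(* If both rooms added the same [t], it would lie strictly above the minimum of [D] in all of [C],
   against dominance. *)
case=> /setP /(_ t); rewrite !inE eqxx (negPf (not_exceed_D ri Ht)) !orbF.
move=> /esym; rewrite -/(is_true _) => /eqP E; subst s.
have [l lC Hl] := dominantP _ _ domDC t.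
have [Eli|li] := eqVneq l i.
  have := exceedP _ _ Hs l lC; rewrite Eli ij => /(_ isT).
  by rewrite -Eli ltnNge Hl.
by have := exceedP _ _ Ht l lC li; rewrite ltnNge Hl.
Qed.

End InnerDoor.

(** * Parity count over almost fully labelled doors *)

Section Labelling.
Variables (c : T -> I) (t0 : T) (i0 : I).

(** The points of such a door carry every label of [C] except [i0], each exactly once. *)
Let almost (q : {set T} * {set I}) :=
  [&& dominant q.1 q.2, #|q.2| == #|q.1|.+1, i0 \in q.2 & c @: q.1 == q.2 :\ i0].

Lemma dominant_inhab (D : {set T}) (C : {set I}) : dominant D C -> exists i, i \in C.
Proof. by move=> /dominantP/(_ t0)[i iC _]; exists i. Qed.

(** Dominance forces [C = [set i0]], and then the single point has to maximize [v i0]. *)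
Let outer_rooms :
  #|[set r | room r && incident (set0, [set i0]) r]| = 1.
Proof.
pose m := [arg max_(t > t0) v i0 t].
have mP s : v i0 s <= v i0 m by rewrite /m; case: arg_maxnP => // t _; apply.
apply/eqP/cards1P; exists ([set m], [set i0]).
apply/setP => -[D C]; rewrite !inE /room /incident /=.
apply/idP/eqP => [/andP[/andP[domr cardr] /andP[_ sC]]|[-> ->]].
  have [i iC] := dominant_inhab domr.
  have EC : C = [set i0].
    apply/eqP; rewrite eqEsubset sC sub1set.
    by move: (subsetP sC i iC); rewrite inE => /eqP <-.
  move: cardr; rewrite {}EC cards1 in domr * => /cards1P[t Et].
  rewrite Et in domr *; congr (_, _); congr [set _]; apply: (@v_inj i0).
  apply/eqP; rewrite eqn_leq mP /=.
  have [l] := dominantP _ _ domr m; rewrite inE => /eqP -> H.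
  by apply: H; rewrite inE.
rewrite !cards1 eqxx sub0set subxx !andbT; apply/dominantP => s.
by exists i0; rewrite ?inE // => d; rewrite inE => /eqP ->.
Qed.

(** There is a door only if removing some [t] from [D] leaves the labels [C :\ i0]. Either [c t]
    repeats the label of a unique [s], and the doors remove [t] or [s]; or [c t] lies outside [C],
    and the doors remove [t] or add [c t] to [C]. *)
Let not_full_even r : room r -> c @: r.1 != r.2 ->
  ~~ odd #|[set q | almost q && incident q r]|.
Proof.
case: r => D C /=; rewrite /room /= => /andP[domr /eqP cardr] nfull.
pose good t := [&& t \in D, i0 \in C & c @: (D :\ t) == C :\ i0].
have doorP D0 C0 : almost (D0, C0) && incident (D0, C0) (D, C) ->
    (exists t, [/\ good t, D0 = D :\ t & C0 = C]) \/
    (exists i, [/\ i \notin C, i0 \in C, i != i0, c @: D = (i |: C) :\ i0 &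
       D0 = D /\ C0 = i |: C]).
  rewrite /almost /incident /=.
  case/andP => /and4P[dom0 /eqP card0 i0C0 /eqP c0] /andP[sD sC].
  have := subset_leq_card sD; have := subset_leq_card sC => leC leD.
  have [ED|neD] := eqVneq D0 D.
    right; subst D0.
    have /cards1P[i Ei] : #|C0 :\: C| == 1.
      by rewrite cardsD (setIidPr sC) card0 -cardr subSnn.
    have : i \in C0 :\: C by rewrite Ei set11.
    rewrite inE => /andP[iC iC0].
    have EC0 : C0 = i |: C by rewrite -(setID C0 C) (setIidPr sC) Ei setUC.
    have ii0 : i != i0.
      apply: contra_neq nfull => E; rewrite c0 EC0 E setU1K //.
      by rewrite -E.
    exists i; split=> //; last by rewrite c0 EC0.
    by move: i0C0; rewrite EC0 !inE eq_sym (negPf ii0).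
  left; have ltD : #|D0| < #|D| by apply: proper_card; rewrite properEneq neD.
  have EC : C = C0 by apply/eqP; rewrite eqEcard sC; lia.
  subst C0; have /cards1P[t Et] : #|D :\: D0| == 1.
    by rewrite cardsD (setIidPr sD); apply/eqP; lia.
  have ED0 : D0 = D :\ t.
    by rewrite -Et setDDr setDv set0U (setIidPr sD).
  have tD : t \in D :\: D0 by rewrite Et set11.
  exists t; rewrite /good i0C0 -ED0 c0 eqxx !andbT; split => //.
  by move: tD; rewrite inE => /andP[].
have good_door t : good t -> almost (D :\ t, C) && incident (D :\ t, C) (D, C).
  case/and3P => tD i0C /eqP ct; rewrite /almost /incident /= ct i0C eqxx subxx.
  rewrite subsetDl !andbT (dominantW (subsetDl _ _) (subxx C) domr) /=.
  by rewrite -cardr (cardsD1 t D) tD.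
have good_inj t : good t -> {in D :\ t &, injective c}.
  case/and3P => tD i0C /eqP ct; apply/imset_injP.
  have := cardsD1 t D; have := cardsD1 i0 C.
  by rewrite ct tD i0C -cardr => -> /addnI ->.
have [[t gt]|nogood] := pselect (exists t, good t); last first.
  suff -> : [set q | almost q && incident q (D, C)] = set0 by rewrite cards0.
  apply/setP => -[D0 C0]; rewrite in_set [RHS]inE; apply/negP => /doorP[].
    by case=> t [gt _ _]; apply: nogood; exists t.
  (* The point labelled [i] would be a good one to remove. *)
  case=> i [iC i0C ii0 cD _]; apply: nogood.
  have : i \in c @: D by rewrite cD !inE ii0 eqxx.
  case/imsetP => t tD Ei; exists t; rewrite /good tD i0C /=.
  have injc : {in D &, injective c}.
    apply/imset_injP; rewrite cD cardr.
    have := cardsU1 i C; rewrite iC (cardsD1 i0 (i |: C)) !inE i0C orbT.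
    by rewrite add1n add1n => -[->].
  have -> : c @: (D :\ t) = (c @: D) :\ i.
    apply/setP => j; rewrite !inE; apply/imsetP/andP.
      case=> s; rewrite !inE => /andP[st sD] ->; split; last exact: imset_f.
      by rewrite Ei; apply: contra_neq st; apply: injc.
    case=> ji /imsetP[s sD Es]; exists s => //; rewrite !inE sD andbT.
    by apply: contra_neq ji => st; rewrite Es Ei st.
  rewrite cD; apply/eqP/setP => j; rewrite !inE.
  by case: (eqVneq j i) => [->|]; rewrite ?(negPf iC) ?andbF //= andbC.
have /and3P[tD i0C /eqP ct] := gt.
have cti0 : c t != i0.
  apply: contra_neq nfull => E.
  by rewrite -(setD1K tD) imsetU1 ct E setD1K.
have [ctC|ctC] := boolP (c t \in C).
  have : c t \in c @: (D :\ t) by rewrite ct !inE cti0.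
  case/imsetP => s; rewrite !inE => /andP[st sD] cts.
  have gs : good s.
    rewrite /good sD i0C -ct /=; apply/eqP/setP => j.
    apply/imsetP/imsetP => -[x]; rewrite !inE => /andP[xn xD] ->.
      have [->|xt] := eqVneq x t; first by exists s; rewrite ?inE ?st.
      by exists x; rewrite ?inE ?xt.
    have [->|xs] := eqVneq x s; first by exists t; rewrite ?inE ?tD ?andbT // eq_sym.
    by exists x; rewrite ?inE ?xs.
  suff -> : [set q | almost q && incident q (D, C)] = [set (D :\ t, C); (D :\ s, C)].
    rewrite cards2; suff -> : (D :\ t, C) != (D :\ s, C) by [].
    by apply/eqP => -[/setP /(_ s)]; rewrite !inE eqxx st sD.
  apply/setP => -[D0 C0]; rewrite in_set in_set2; apply/idP/idP; last first.
    by case/orP => /eqP ->; apply: good_door.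
  case/doorP => [[x [gx -> ->]]|[i [iC _ ii0 cD _]]].
    have [->|xt] := eqVneq x t; first by rewrite eqxx.
    have [->|xs] := eqVneq x s; first by rewrite eqxx orbT.
    have := good_inj x gx t s; rewrite !inE tD sD eq_sym xt eq_sym xs.
    by move=> /(_ isT isT cts) E; rewrite E eqxx in st.
  have : i \in c @: D by rewrite cD !inE ii0 eqxx.
  case/imsetP => x xD Ei; have [E|xt] := eqVneq x t.
    by rewrite Ei E ctC in iC.
  have : c x \in c @: (D :\ t) by apply: imset_f; rewrite !inE xt.
  by rewrite -Ei ct !inE (negPf iC) andbF.
have door2 : almost (D, c t |: C) && incident (D, c t |: C) (D, C).
  rewrite /almost /incident /= subxx subsetUr (dominantW (subxx D) (subsetUr _ _) domr).
  rewrite cardsU1 ctC cardr eqxx !inE i0C orbT !andbT /= -{1}(setD1K tD) imsetU1 ct.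
  apply/eqP/setP => j; rewrite !inE.
  by have [->|] := eqVneq j (c t); rewrite ?cti0.
suff -> : [set q | almost q && incident q (D, C)] = [set (D :\ t, C); (D, c t |: C)].
  rewrite cards2; suff -> : (D :\ t, C) != (D, c t |: C) by [].
  by apply/eqP => -[/setP /(_ t)]; rewrite !inE eqxx tD.
apply/setP => -[D0 C0]; rewrite in_set in_set2; apply/idP/idP; last first.
  by case/orP => /eqP ->; [apply: good_door|].
case/doorP => [[x [gx -> ->]]|[i [iC _ ii0 cD [-> ->]]]].
  have [->|xt] := eqVneq x t; first by rewrite eqxx.
  have /and3P[_ _ /eqP cx] := gx.
  have : c t \in c @: (D :\ x) by apply: imset_f; rewrite !inE eq_sym xt.
  by rewrite cx !inE (negPf ctC) andbF.
have : i \in c @: D by rewrite cD !inE ii0 eqxx.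
case/imsetP => x xD Ei; have [E|xt] := eqVneq x t.
  by rewrite Ei E eqxx orbT.
have : c x \in c @: (D :\ t) by apply: imset_f; rewrite !inE xt.
by rewrite -Ei ct !inE (negPf iC) andbF.
Qed.

(* Every almost-labelled door lies in two rooms except (set0, {i0}),
   which lies in one, whereas a room that is not fully labelled has zero or
   two almost-labelled doors. *)
Lemma labelled_dominant_set :
  exists D C, [/\ dominant D C, #|D| = #|C| & c @: D = C].
Proof.
have [//|nofull] := pselect (exists D C, [/\ dominant D C, #|D| = #|C| & c @: D = C]).
pose N := \sum_(q | almost q) \sum_(r | room r) incident q r.
have oddN : odd N.
  have aq0 : almost (set0, [set i0]).
    rewrite /almost /= cards1 cards0 eqxx set11 setDv imset0 eqxx !andbT.
    by apply/dominantP => s; exists i0; rewrite ?set11 // => d; rewrite inE.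
  have cnt q : \sum_(r | room r) incident q r = #|[set r | room r && incident q r]|.
    rewrite -sum1dep_card -big_mkcondr /=; apply: eq_bigr => r _.
    by [].
  rewrite /N (bigD1 _ aq0) /= cnt outer_rooms oddD /= (big_morph odd oddD (erefl _)).
  rewrite big1 // => -[D C] /andP[/and4P[/= dom0 /eqP card0 i0C /eqP cD] ne].
  (* With [D] empty, [C] is [[set i0]]: the outer door, already counted. *)
  have [ED|[d dD]] := set_0Vmem D.
    case/negP: ne; move: cD card0 i0C; rewrite {}ED imset0 cards0 => _ /eqP/cards1P[i ->].
    by rewrite inE => /eqP ->.
  by rewrite cnt (inner_door_rooms dom0 dD card0).
suff : ~~ odd N by rewrite oddN.
rewrite /N exchange_big /= (big_morph odd oddD (erefl _)).
rewrite big1 // => r rr; apply/negbTE.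
suff -> : \sum_(q | almost q) incident q r = #|[set q | almost q && incident q r]|.
  apply: not_full_even => //; apply/eqP => Er; apply: nofull.
  by move: rr => /andP[domr /eqP cardr]; exists r.1, r.2.
by rewrite -sum1dep_card -big_mkcondr.
Qed.

End Labelling.
End Scarf.

From mathcomp Require Import classical_sets filter reals topology normedtype.
From mathcomp Require Import sequences exp ring lra.
Import Order.TTheory GRing.Theory Num.Theory.
Import numFieldNormedType.Exports.
Local Open Scope classical_set_scope.
Local Open Scope ring_scope.

(** * Brouwer's theorem on a simplex *)

Section Sequences.
Variable R : realType.

Lemma cvgn_sum (J : finType) (P : pred J) (u : nat -> J -> R) (l : J -> R) :
  (forall j, P j -> u n j @[n --> \oo] --> l j) ->
  \sum_(j | P j) u n j @[n --> \oo] --> \sum_(j | P j) l j.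
Proof. by move=> H; apply: (@cvg_big _ _ _ _ P (@add_continuous _) _ _ _ (fun j n => u n j)) => //. Qed.

Lemma cvgn_prod (J : finType) (P : pred J) (u : nat -> J -> R) (l : J -> R) :
  (forall j, P j -> u n j @[n --> \oo] --> l j) ->
  \prod_(j | P j) u n j @[n --> \oo] --> \prod_(j | P j) l j.
Proof. by move=> H; apply: (@cvg_big _ _ _ _ P (@mul_continuous _) _ _ _ (fun j n => u n j)) => //. Qed.

(** The condition [n <= phi n] sends tails into tails and is stable under composition, so it serves
    as the notion of subsequence throughout. *)
Lemma cvgn_subseq (u : nat -> R) (l : R) (phi : nat -> nat) :
  (forall n, (n <= phi n)%N) -> u n @[n --> \oo] --> l -> u (phi n) @[n --> \oo] --> l.
Proof.
move=> Hphi Hu; apply: (cvg_comp phi u _ Hu) => A [N _ HN]; exists N => // n /= Nn.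
by apply: HN => /=; apply: leq_trans Nn (Hphi n).
Qed.

(** Subsequences are extracted for one index after another; each extraction keeps the earlier
    limits. *)
Lemma bolzano_weierstrass_fin (J : finType) (x : nat -> J -> R) (M : R) :
  (forall n j, `|x n j| <= M) ->
  exists phi : nat -> nat, (forall n, (n <= phi n)%N) /\
    forall j, cvgn (fun n => x (phi n) j).
Proof.
move=> bx.
suff [phi [Hphi Hx]] : exists phi : nat -> nat, (forall n, (n <= phi n)%N) /\
    forall j, j \in enum J -> cvgn (fun n => x (phi n) j).
  by exists phi; split=> // j; apply: Hx; rewrite mem_enum.
elim: (enum J) => [|a s [phi [Hphi Hx]]]; first by exists id.
have [|psi psi_incr psiP] := @bolzano_weierstrass R (fun n => x (phi n) a).
  exists M; split; first exact: num_real.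
  by move=> K MK n _ /=; apply: le_trans (bx _ _) (ltW MK).
have psi_ge n : (n <= psi n)%N.
  elim: n => // n IH; apply: leq_ltn_trans IH _.
  by move/increasing_seqP: psi_incr => /(_ n); rewrite ltEnat.
exists (phi \o psi); split=> [n|j]; first by apply: leq_trans (psi_ge n) (Hphi _).
rewrite inE => /orP[/eqP ->|/Hx /cvg_ex[l Hl]]; first exact: psiP.
by apply/cvg_ex; exists l; apply: (cvgn_subseq psi_ge Hl).
Qed.

Lemma cvgn_squeeze_dist (u w : nat -> R) (l : R) (K : R) :
  (forall n, `|u n - w n| <= K / n.+1%:R) -> u n @[n --> \oo] --> l ->
  w n @[n --> \oo] --> l.
Proof.
move=> H Hu; apply/cvgrPdist_lt => e e0.
have He : 0 < e / 2 by lra.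
have HK : K / n.+1%:R @[n --> \oo] --> (K * 0 : R).
  by apply: cvgM; [exact: cvg_cst | exact: cvg_harmonic].
rewrite mulr0 in HK.
move/cvgrPdist_lt/(_ _ He): Hu => Hu; move/cvgrPdist_lt/(_ _ He): HK => HK.
near=> n.
have h1 : `|l - u n| < e / 2 by near: n.
have h2 : `|0 - K / n.+1%:R| < e / 2 by near: n; exact: HK.
have h3 := H n.
have -> : l - w n = (l - u n) + (u n - w n) by lra.
apply: le_lt_trans (ler_normD _ _) _.
rewrite sub0r normrN in h2.
rewrite [e]splitr; apply: ltrD => //.
exact: le_lt_trans (le_trans h3 (ler_norm _)) h2.
Unshelve. all: by end_near.
Qed.

End Sequences.

Section Brouwer.
Variables (R : realType) (J : finType) (j0 : J).

(** * Approximate fixed points on a grid of mesh [1 / N] *)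

Section Grid.
Variables (N : nat) (f : (J -> R) -> J -> R).
Hypothesis N0 : (0 < N)%N.
Hypothesis f_dist : forall x, is_dist x -> is_dist (f x).

Let T := {x : {ffun J -> 'I_N.+1} | (\sum_j x j)%N == N}.
Let pt (t : T) (j : J) : R := (val t j)%:R / N%:R.

Let pt_dist t : is_dist (pt t).
Proof.
split=> [j|]; first by rewrite divr_ge0 ?ler0n.
rewrite -mulr_suml -natr_sum (eqP (valP t)) divff // pnatr_eq0; lia.
Qed.

(** Both vectors sum to 1, so [f (pt t)] cannot be smaller in every coordinate. *)
Let label_ex t : exists j, pt t j <= f (pt t) j.
Proof.
have [//|H] := pselect (exists j, pt t j <= f (pt t) j).
have lt j : f (pt t) j < pt t j.
  by rewrite ltNge; apply/negP => Hj; apply: H; exists j.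
have : \sum_j f (pt t) j < \sum_j pt t j.
  by apply: ltr_sum => //; apply/hasP; exists j0; rewrite ?mem_index_enum.
by rewrite (f_dist (pt_dist t)).2 (pt_dist t).2 ltxx.
Qed.

Let label t := projT1 (cid (label_ex t)).
Let labelP t : pt t (label t) <= f (pt t) (label t).
Proof. exact: projT2 (cid (label_ex t)). Qed.

(* coordinate orders on the grid, with ties broken by rank *)
Let v (j : J) (t : T) : nat := (val t j * #|{: T}| + enum_rank t)%N.

Let v_inj j : injective (v j).
Proof.
move=> s t /(congr1 (modn^~ #|{: T}|)); rewrite /v !modnMDl !modn_small //.
by move=> /val_inj/enum_rank_inj.
Qed.

Let v_lt j (s t : T) : (val s j < val t j)%N -> (v j s < v j t)%N.
Proof.
move=> H; rewrite /v; apply: leq_trans (_ : (val s j).+1 * #|{: T}| <= _)%N.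
  by rewrite mulSn addnC ltn_add2r ltn_ord.
by apply: leq_trans (leq_addr _ _); rewrite leq_mul2r H orbT.
Qed.

Let grid_of (x : J -> nat) : (\sum_j x j)%N = N -> exists t : T, forall j, val t j = x j :> nat.
Proof.
move=> Hx.
have xN j : (x j < N.+1)%N by rewrite ltnS -Hx (bigD1 j) //= leq_addr.
pose y := [ffun j => Ordinal (xN j)].
have yN : (\sum_j y j)%N == N by rewrite -[X in _ == X]Hx; apply/eqP/eq_bigr => j _; rewrite ffunE.
by exists (exist _ y yN) => j; rewrite /= ffunE.
Qed.

(* Points of a dominant pair (D, C) are clustered: were their minimal
   coordinates [m i] over [C] to satisfy [\sum_C (m i + 1) <= N], some grid
   point would exceed [D] in every coordinate of [C]. *)
Lemma approximate_fixpoint : exists s : J -> J -> R,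
  [/\ forall i, is_dist (s i),
      forall i j k, `|s i k - s j k| <= #|J|%:R / N%:R &
      forall i, s i i <= f (s i) i + #|J|%:R / N%:R].
Proof.
have [t0 _] : exists t : T, forall j, val t j = (if j == j0 then N else 0%N) :> nat.
  by apply: grid_of; rewrite -big_mkcond /= big_pred1_eq.
have [D [C [domDC cardDC cDC]]] := labelled_dominant_set v_inj label t0 j0.
have [i0 i0C] := dominant_inhab t0 domDC.
have [d0 d0D] : exists d, d \in D.
  by apply/card_gt0P; rewrite cardDC; apply/card_gt0P; exists i0.
pose a i := [arg min_(d < d0 in D) (val d i : nat)].
have aP i : a i \in D /\ forall d, d \in D -> (val (a i) i <= val d i)%N.
  by rewrite /a; case: arg_minnP => // d dD Hd; split=> // e /Hd.
pose m i : nat := val (a i) i.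
have large : (N < \sum_(i in C) (m i).+1)%N.
  rewrite ltnNge; apply/negP => small.
  (* The surplus goes to [i0], so the coordinates sum to [N] and give a grid point above every
     [m i]. *)
  pose x j := if j \in C then ((m j).+1 + (if j == i0 then N - \sum_(i in C) (m i).+1 else 0))%N else 0%N.
  have [t Ht] : exists t : T, forall j, val t j = x j :> nat.
    apply: grid_of; rewrite -big_mkcond /= big_split /= -big_mkcondr /=.
    have -> r : (\sum_(i in C | i == i0) r = r)%N.
      by rewrite (big_pred1 i0) // => i /=; case: eqP => [->|_]; rewrite ?i0C ?andbF.
    exact: subnKC.
  have [i iC Hi] := dominantP _ _ _ domDC t.
  have := Hi _ (aP i).1; rewrite leqNgt v_lt //.
  by rewrite Ht /x iC /m addSn ltnS leq_addr.
have mlarge : (N <= \sum_(i in C) m i + #|J|)%N.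
  move: large; under eq_bigr do rewrite -addn1.
  rewrite big_split /= sum1_card => H; apply: leq_trans (ltnW H) _.
  by rewrite leq_add2l max_card.
pose m' i := if i \in C then m i else 0%N.
have m'le d i : d \in D -> (m' i <= val d i)%N.
  by rewrite /m'; case: ifP => // iC dD; apply: (aP i).2.
have m'large : (N <= \sum_i m' i + #|J|)%N by rewrite -big_mkcond.
(* The other coordinates are at least [m'], whose total falls short of [N] by at most [#|J|]; this
   bounds the excess in coordinate [i]. *)
have clustered d i : d \in D -> (val d i <= m' i + #|J|)%N.
  move=> dD; have := eqP (valP d); rewrite (bigD1 i) //=.
  move: m'large; rewrite (bigD1 i) //=.
  have : (\sum_(j | j != i) m' j <= \sum_(j | j != i) val d j)%N.
    by apply: leq_sum => j _; apply: m'le.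
  rewrite /=; lia.
(* For [i] outside [C] any point of [D] serves, since its coordinate [i] is at most [#|J|]. *)
have sel i : exists d, d \in D /\ (i \in C -> label d = i).
  have [iC|] := boolP (i \in C); last by exists d0.
  by move: iC; rewrite -{1}cDC => /imsetP[d dD ->]; exists d.
pose s i := projT1 (cid (sel i)).
have sD i : s i \in D by case: (projT2 (cid (sel i))).
have sl i : i \in C -> label (s i) = i by case: (projT2 (cid (sel i))).
have NR : 0 < N%:R :> R by rewrite ltr0n.
exists (fun i => pt (s i)); split=> [i|i j k|i].
- exact: pt_dist.
- rewrite /pt -mulrBl normrM (ger0_norm (x := _^-1)) ?invr_ge0 ?ler0n //.
  rewrite ler_pM2r ?invr_gt0 // ler_norml.
  have h1 := clustered _ k (sD i); have h2 := m'le _ k (sD i).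
  have h3 := clustered _ k (sD j); have h4 := m'le _ k (sD j).
  by apply/andP; split; [rewrite lerNl opprB|]; rewrite lerBlDl -natrD ler_nat;
    [apply: leq_trans h3 _|apply: leq_trans h1 _]; rewrite leq_add2r.
have [iC|iC] := boolP (i \in C).
  have := labelP (s i); rewrite (sl i iC) => H; apply: le_trans H _.
  by rewrite lerDl divr_ge0 ?ler0n.
apply: le_trans (_ : #|J|%:R / N%:R <= _); last first.
  by rewrite lerDr; apply: (f_dist (pt_dist _)).1.
rewrite /pt ler_pM2r ?invr_gt0 // ler_nat.
by have := clustered _ i (sD i); rewrite /m' (negPf iC).
Qed.
End Grid.

(** For finer and finer grids the approximate fixed points cluster at one [x]. In the limit
    [x j <= f x j] for every [j], and the equal sums turn this into equality. *)
Theorem brouwer_simplex (f : (J -> R) -> J -> R) :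
  (forall x, is_dist x -> is_dist (f x)) ->
  (forall (x : nat -> J -> R) (l : J -> R), (forall n, is_dist (x n)) -> is_dist l ->
     (forall j, x n j @[n --> \oo] --> l j) ->
     forall j, f (x n) j @[n --> \oo] --> f l j) ->
  exists x, is_dist x /\ forall j, f x j = x j.
Proof.
move=> f_dist f_cont.
pose s n := projT1 (cid (approximate_fixpoint (ltn0Sn n) f_dist)).
have sP n := projT2 (cid (approximate_fixpoint (ltn0Sn n) f_dist)).
have s_dist n i : is_dist (s n i) by have [H _ _] := sP n; exact: H.
have s_close n i j k : `|s n i k - s n j k| <= #|J|%:R / n.+1%:R.
  by have [_ H _] := sP n; exact: H.
have s_fix n i : s n i i <= f (s n i) i + #|J|%:R / n.+1%:R.
  by have [_ _ H] := sP n; exact: H.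
have dist_le1 (p : J -> R) j : is_dist p -> `|p j| <= 1.
  move=> [p0 p1]; rewrite ger0_norm // -p1 (bigD1 j) //= lerDl.
  by apply: sumr_ge0.
have [phi [Hphi cvx]] := bolzano_weierstrass_fin (fun n j => dist_le1 (s n j0) j (s_dist n j0)).
pose x j := lim ((s (phi n) j0 j) @[n --> \oo]).
have sx i j : s (phi n) i j @[n --> \oo] --> x j.
  apply: (@cvgn_squeeze_dist _ (fun n => s (phi n) j0 j) _ _ #|J|%:R) (cvx j) => n.
  apply: le_trans (s_close _ _ _ _) _.
  by rewrite ler_wpM2l ?ler0n // lef_pV2 ?posrE ?ltr0n // ler_nat ltnS.
have x_dist : is_dist x.
  split=> [j|].
    apply: (limr_ge (cvx j)); near=> n; exact: (s_dist _ _).1.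
  have H : \sum_j s (phi n) j0 j @[n --> \oo] --> \sum_j x j by apply: cvgn_sum => j _; exact: sx.
  have H1 : \sum_j s (phi n) j0 j @[n --> \oo] --> (1 : R).
    by under eq_cvg do rewrite (s_dist _ _).2; exact: cvg_cst.
  exact: (cvg_unique _ H H1).
have x_le j : x j <= f x j.
  have H : f (s (phi n) j) j + #|J|%:R / (phi n).+1%:R @[n --> \oo] --> f x j + #|J|%:R * 0.
    apply: cvgD.
      by apply: (f_cont (fun n => s (phi n) j)) => // k; exact: sx.
    apply: cvgM; first exact: cvg_cst.
    exact: (cvgn_subseq Hphi (@cvg_harmonic R)).
  rewrite mulr0 addr0 in H.
  by apply: (ler_cvg_to (sx j j) H); near=> n; exact: s_fix.
exists x; split=> // j; apply/eqP; rewrite eq_sym -subr_eq0 -oppr_eq0 opprB.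
have : \sum_k (f x k - x k) == 0 by rewrite sumrB (f_dist _ x_dist).2 x_dist.2 subrr.
rewrite psumr_eq0 => [|k _]; last by rewrite subr_ge0.
by move=> /allP/(_ j (mem_index_enum _)).
Unshelve. all: by end_near.
Qed.
End Brouwer.

(** * Continuation values under a K-based profile *)

(** The distributive law of products over sums, transferred from [fprod] to dependent functions. *)
Lemma sum_prod_dffun (R : comRingType) (I : finType) (T : I -> finType)
    (p : forall i, T i -> R) :
  \sum_(f : {dffun forall i, T i}) \prod_i p i (f i) = \prod_i \sum_(u : T i) p i u.
Proof.
pose q i := [ffun u => p i u].
transitivity (\prod_i \sum_(u : T i) q i u); last first.
  by apply: eq_bigr => i _; apply: eq_bigr => u _; rewrite ffunE.
under [RHS]eq_bigr do rewrite (big_tag (fun i u => q i u)).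
rewrite bigA_distr_big_dep -big_fprod.
rewrite (reindex (@dffun_of_fprod I T)) /=; last first.
  by exists (@fprod_of_dffun I T) => x _; rewrite ?dffun_of_fprodK ?fprod_of_dffunK.
by apply: eq_bigr => f _; apply: eq_bigr => i _; rewrite !ffunE.
Qed.

(** [F] is absorbed into factor [i]; every other factor sums to 1. *)
Lemma sum_prod_dffun_marginal (R : numDomainType) (I : finType) (T : I -> finType)
    (p : forall i, T i -> R) (i : I) (F : T i -> R) :
  (forall j, is_dist (p j)) ->
  \sum_(f : {dffun forall i, T i}) (\prod_j p j (f j)) * F (f i) = \sum_u p i u * F u.
Proof.
move=> p_dist; pose q := dfwith p (fun u => p i u * F u).
transitivity (\sum_(f : {dffun forall i, T i}) \prod_j q j (f j)).
  apply: eq_bigr => f _; rewrite (bigD1 i) //= [RHS](bigD1 i) //= /q dfwith_in.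
  rewrite mulrAC; congr (_ * _); apply: eq_bigr => j ji.
  by rewrite dfwith_out // eq_sym.
rewrite (@sum_prod_dffun R I T q) (bigD1 i) //= [X in _ * X]big1 ?mulr1 => [|j ji].
  by apply: eq_bigr => u _; rewrite /q dfwith_in.
rewrite -[RHS](p_dist j).2; apply: eq_bigr => u _.
by rewrite /q dfwith_out // eq_sym.
Qed.

(** * Trajectory masses, rewards and reachability *)

Section GameValues.
Variables (R : realType) (G : game R).

Lemma sum_traj (t : nat) (F : Traj G t.+1 -> R) :
  \sum_om F om = \sum_(o : Traj G t) \sum_w \sum_us F (o, w, us).
Proof.
rewrite pair_bigA /= pair_bigA /=.
by apply: eq_bigr => -[[o w] us].
Qed.

(** The noise and the other players' actions sum out to 1, leaving player [i]'s own choice. *)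
Lemma sum_fwd (g : profile G) (t : nat) (i : player G) (m : Traj G t -> R)
    (F : Traj G t -> Us G t i -> R) :
  valid_profile g -> (t < horizon G)%N ->
  \sum_om fwd g m om * F om.1.1 (om.2 i) =
  \sum_o m o * \sum_u g t i (hist i o) u * F o u.
Proof.
move=> vg tT; rewrite sum_traj; apply: eq_bigr => o _.
transitivity (\sum_w m o * (PW G (t := t) w * \sum_u g t i (hist i o) u * F o u)).
  apply: eq_bigr => w _; rewrite /fwd /=.
  rewrite -(@sum_prod_dffun_marginal _ _ _ (fun j => g t j (hist j o)) i (F o)).
    by rewrite !mulr_sumr; apply: eq_bigr => us _; rewrite !mulrA.
  by move=> j; apply: vg.
by rewrite -mulr_sumr -mulr_suml (PW_dist _ G t tT).2 mul1r.
Qed.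

(** The mass [m] is not normalized, which avoids conditioning. With [tau = t.+1] the reward is that
    of time [t + k]. *)
Definition value (g : profile G) (i : player G) (tau k : nat) (m : Traj G tau -> R) : R :=
  \sum_(om : Traj G (Nat.add k tau)) fwdk R G g tau k m om * lastrew i om.

(* [Nat.add k.+1 t] and [Nat.add k t.+1] are not convertible, so the shift is
   expressed between dependent pairs. *)
Lemma fwdk_shift (g : profile G) (tau k : nat) (m : Traj G tau -> R) :
  existT (fun s => Traj G s -> R) _ (fwdk R G g tau k.+1 m) =
  existT (fun s => Traj G s -> R) _ (fwdk R G g tau.+1 k (fwd g m)).
Proof.
elim: k => [//|k IH].
exact: (congr1 (fun p : {s & Traj G s -> R} =>
  existT (fun s => Traj G s -> R) (projT1 p).+1 (fwd g (projT2 p))) IH).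
Qed.

Lemma value_fwd (g : profile G) (i : player G) (tau k : nat) (m : Traj G tau -> R) :
  value g i k.+1 m = value g i k (fwd g m).
Proof.
exact: (congr1 (fun p : {s & Traj G s -> R} =>
  \sum_om projT2 p om * lastrew i om) (fwdk_shift g k m)).
Qed.

(** The masses [prob_on] are the case of an indicator [psi]. Arbitrary weights are closed under
    [fwd], as the induction on the number of steps needs. *)
Definition weighted (g : profile G) (i : player G) (t : nat)
    (psi : Hist (G := G) i t -> Us G t i -> R) : Traj G t.+1 -> R :=
  fun om => prob g om * psi (hist i om.1.1) (om.2 i).

(** Perfect recall: the action of time [t] is read off the new information through [act]. *)
Lemma fwd_weighted (g : profile G) (i : player G) (t : nat) psi :
  (t < horizon G)%N ->
  fwd g (weighted g psi) =
  weighted g (fun (h : Hist (G := G) i t.+1) (_ : Us G t.+1 i) => psi h.1 (act G h.2)).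
Proof.
move=> tT; apply/funext => -[[o w] us]; rewrite /fwd /weighted /= act_component //.
by rewrite mulrAC -!mulrA; congr (_ * _); rewrite /fwd /=; ring.
Qed.

Lemma sum_weighted (g : profile G) (i : player G) (t : nat)
    (psi : Hist (G := G) i t -> Us G t i -> R) (F : Traj G t.+1 -> R) :
  \sum_om weighted g psi om * F om =
  \sum_h \sum_u psi h u * \sum_om prob_on g h u om * F om.
Proof.
transitivity (\sum_h \sum_u \sum_om psi h u * (prob_on g h u om * F om)); last first.
  by apply: eq_bigr => h _; apply: eq_bigr => u _; rewrite mulr_sumr.
rewrite (eq_bigr _ (fun h _ => exchange_big _ _ _ _ _ _)) exchange_big /=.
apply: eq_bigr => om _; rewrite (bigD1 (hist i om.1.1)) //= (bigD1 (om.2 i)) //=.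
rewrite /prob_on /weighted !eqxx /= mulr1 big1 ?addr0 => [|u /negPf ne]; last first.
  by rewrite eq_sym ne mulr0 mul0r mulr0.
rewrite big1 ?addr0 => [|h /negPf ne]; first by rewrite mulrA [_ * psi _ _]mulrC.
by apply: big1 => u _; rewrite eq_sym ne mulr0 mul0r mulr0.
Qed.

Lemma sum_weighted_last (g : profile G) (i : player G) (t : nat)
    (psi e : Hist (G := G) i t -> Us G t i -> R) :
  \sum_om weighted g psi om * e (hist i om.1.1) (om.2 i) =
  \sum_h \sum_u psi h u * (Pr_hu g h u * e h u).
Proof.
rewrite (sum_weighted g psi (fun om => e (hist i om.1.1) (om.2 i))).
apply: eq_bigr => h _; apply: eq_bigr => u _; congr (_ * _).
rewrite /Pr_hu mulr_suml; apply: eq_bigr => om _; rewrite /prob_on.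
case: eqP => [->|_] /=; last by rewrite mulr0 !mul0r.
by case: eqP => [->|_] //; rewrite mulr0 !mul0r.
Qed.

Lemma prob_ge0 (g : profile G) (t : nat) (om : Traj G t) :
  valid_profile g -> (t <= horizon G)%N -> 0 <= prob g om.
Proof.
move=> vg; elim: t om => [|t IH] om tT /=; first exact: (P0_dist _ G).1.
rewrite /fwd !mulr_ge0 ?IH ?(ltnW tT) ?(PW_dist _ G t tT).1 //.
by apply: prodr_ge0 => j _; apply: (vg t tT j _).1.
Qed.

Lemma prob_on_ge0 (g : profile G) i (t : nat) (h : Hist (G := G) i t) u om :
  valid_profile g -> (t < horizon G)%N -> 0 <= prob_on g h u om.
Proof. by move=> vg tT; rewrite mulr_ge0 ?prob_ge0 // ler0n. Qed.

Lemma Pr_hu_ge0 (g : profile G) i (t : nat) (h : Hist (G := G) i t) u :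
  valid_profile g -> (t < horizon G)%N -> 0 <= Pr_hu g h u.
Proof. by move=> vg tT; apply: sumr_ge0 => om _; apply: prob_on_ge0. Qed.

Lemma prob_on_eq0 (g : profile G) i (t : nat) (h : Hist (G := G) i t) u om :
  valid_profile g -> (t < horizon G)%N -> Pr_hu g h u = 0 -> prob_on g h u om = 0.
Proof.
move=> vg tT /eqP; rewrite psumr_eq0 => [|o _]; last exact: prob_on_ge0.
by move=> /allP/(_ om (mem_index_enum _)) /eqP.
Qed.

Definition reach (g : profile G) i (t : nat) (h : Hist (G := G) i t) : R :=
  \sum_(o : Traj G t) prob g o * (hist i o == h)%:R.

Lemma Pr_hu_reach (g : profile G) i (t : nat) (h : Hist (G := G) i t) u :
  valid_profile g -> (t < horizon G)%N -> Pr_hu g h u = reach g h * g t i h u.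
Proof.
move=> vg tT; rewrite /Pr_hu /prob_on.
rewrite (@sum_fwd g t i (@prob R G g t) (fun o v => ((hist i o == h) && (v == u))%:R)) //.
rewrite /reach mulr_suml; apply: eq_bigr => o _; rewrite -mulrA; congr (_ * _).
have [->|_] := eqVneq; last by rewrite mul0r big1 // => v _; rewrite mulr0.
rewrite (bigD1 u) //= eqxx mulr1 big1 ?addr0 ?mul1r // => v /negPf ->.
by rewrite mulr0.
Qed.

(** All action probabilities being positive, zeros come only from [P0] and [PW], which the two
    profiles share. *)
Lemma prob_support (g g' : profile G) (t : nat) (om : Traj G t) :
  fully_mixed g -> fully_mixed g' -> (t <= horizon G)%N ->
  (prob g om == 0) = (prob g' om == 0).
Proof.
move=> [_ mg] [_ mg']; elim: t om => [//|t IH] om tT /=.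
rewrite /fwd !mulf_eq0 IH ?(ltnW tT) //; congr (_ || _).
have pos (f : profile G) : (forall t, (t < horizon G)%N ->
    forall i (h : Hist (G := G) i t) (u : Us G t i), 0 < f t i h u) ->
    (\prod_j f t j (hist j om.1.1) (om.2 j) == 0) = false.
  by move=> mf; apply/negbTE; rewrite gt_eqF //; apply: prodr_gt0 => j _; apply: mf.
by rewrite !pos.
Qed.

Lemma reach_support (g g' : profile G) i (t : nat) (h : Hist (G := G) i t) :
  fully_mixed g -> fully_mixed g' -> (t <= horizon G)%N ->
  (reach g h == 0) = (reach g' h == 0).
Proof.
move=> mg mg' tT; rewrite /reach !psumr_eq0; last 2 first.
- by move=> o _; rewrite mulr_ge0 ?ler0n // prob_ge0 //; case: mg'.
- by move=> o _; rewrite mulr_ge0 ?ler0n // prob_ge0 //; case: mg.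
by apply: eq_all => o /=; rewrite !mulf_eq0 (prob_support _ mg mg').
Qed.

Lemma Pr_hu_support (g : profile G) i (t : nat) (h : Hist (G := G) i t) u :
  fully_mixed g -> (t < horizon G)%N -> (Pr_hu g h u == 0) = (reach g h == 0).
Proof.
move=> [vg mg] tT; rewrite Pr_hu_reach // mulf_eq0.
by rewrite [X in _ || X]gt_eqF ?orbF //; apply: mg.
Qed.

(** * Continuation values factor through the compression *)

Section MSIvalues.
Variables (C : compression G) (rho : Kprofile C).
Hypotheses (rho_valid : valid_Kprofile rho) (msi : MSI C).

Local Notation g := (@Kbased R G C rho).

Lemma Kbased_valid : valid_profile g.
Proof. by move=> t tT i h; apply: rho_valid. Qed.

(** Induction on [k]: the case 0 is the reward function of the information state. Otherwise one step
    of play leads to a value of the next compressed state, whose law depends only on the current one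
    and the action. Quantifying over [psi] makes the induction hypothesis available after [fwd]. *)
Lemma value_compressed (i : player G) (k t : nat) : (t + k < horizon G)%N ->
  exists e : Ks C t i -> Us G t i -> R,
    (forall c u, `|e c u| <= 1) /\
    forall psi : Hist (G := G) i t -> Us G t i -> R, value g i k (weighted g psi) =
      \sum_om weighted g psi om * e (Defs.comp C (hist i om.1.1)) (om.2 i).
Proof.
have vg := Kbased_valid.
have [P [r [P_dist [r_bound info]]]] := msi i rho_valid.
(* The information state property is used only with player [i] following [rho] as well. *)
have {}info := info g vg (fun t j _ => erefl _).
elim: k t => [|k IH] t tT.
  rewrite addn0 in tT.
  exists (r t); split=> [c u|psi]; first by rewrite ler_norml; apply: r_bound.
  rewrite (sum_weighted_last g psi (fun h u => r t (Defs.comp C h) u)).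
  rewrite /value /= sum_weighted; apply: eq_bigr => h _; apply: eq_bigr => u _.
  (* The information state says nothing about events of probability 0, where both sides vanish. *)
  congr (_ * _); have := Pr_hu_ge0 h u vg tT; rewrite le0r => /orP[/eqP Pr0|Prpos].
    by rewrite Pr0 mul0r; apply: big1 => om _; rewrite prob_on_eq0 // mul0r.
  have [_ <-] := info t tT h u Prpos.
  by rewrite /ER_cond /ER_on mulrC divfK // gt_eqF.
have tT' : (t < horizon G)%N by lia.
have tT1 : (t.+1 < horizon G)%N by lia.
have [|e [e_bound He]] := IH t.+1; first by lia.
pose v c := \sum_u @rho t.+1 i c u * e c u.
have v_bound c : `|v c| <= 1.
  apply: le_trans (ler_norm_sum _ _ _) _; rewrite -(rho_valid tT1 c).2.
  apply: ler_sum => u _; have p0 := (rho_valid tT1 c).1 u.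
  by rewrite normrM ger0_norm // ler_piMr.
exists (fun c u => \sum_c' P t c u c' * v c'); split=> [c u|psi].
  apply: le_trans (ler_norm_sum _ _ _) _; rewrite -(P_dist t tT1 c u).2.
  apply: ler_sum => c' _; have p0 := (P_dist t tT1 c u).1 c'.
  by rewrite normrM ger0_norm // ler_piMr.
rewrite value_fwd fwd_weighted // He.
transitivity (\sum_om weighted g psi om * v (Defs.comp C (hist i om))).
  rewrite -fwd_weighted //.
  exact: (@sum_fwd g t.+1 i (weighted g psi) (fun o u => e (Defs.comp C (hist i o)) u)).
rewrite (sum_weighted_last g psi (fun h u => \sum_c' P t (Defs.comp C h) u c' * v c')).
rewrite sum_weighted; apply: eq_bigr => h _; apply: eq_bigr => u _; congr (_ * _).
have := Pr_hu_ge0 h u vg tT'; rewrite le0r => /orP[/eqP Pr0|Prpos].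
  by rewrite Pr0 mul0r; apply: big1 => om _; rewrite prob_on_eq0 // mul0r.
have [/(_ tT1) HP _] := info t tT' h u Prpos.
transitivity (\sum_om \sum_c' prob_on g h u om * (Defs.comp C (hist i om) == c')%:R * v c').
  apply: eq_bigr => om _; rewrite (bigD1 (Defs.comp C (hist i om))) //= eqxx mulr1.
  by rewrite big1 ?addr0 // => c' /negPf ne; rewrite eq_sym ne mulr0 mul0r.
rewrite exchange_big mulr_sumr; apply: eq_bigr => c' _.
rewrite -HP -mulr_suml mulrA; congr (_ * _).
by rewrite mulrC divfK // gt_eqF.
Qed.

Lemma ER_on_compressed (i : player G) (k t : nat) : (t + k < horizon G)%N ->
  exists e : Ks C t i -> Us G t i -> R,
    (forall c u, `|e c u| <= 1) /\
    forall (h : Hist (G := G) i t) u, ER_on g h u k = Pr_hu g h u * e (Defs.comp C h) u.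
Proof.
move=> tk; have [e [eb He]] := value_compressed i tk; exists e; split=> // h u.
pose psi (h' : Hist (G := G) i t) u' : R := ((h' == h) && (u' == u))%:R.
have := He psi; rewrite (sum_weighted_last g psi (fun h u => e (Defs.comp C h) u)).
rewrite (bigD1 h) //= (bigD1 u) //= /psi !eqxx mul1r.
rewrite big1 ?addr0 => [|u' /negPf ->]; last by rewrite mul0r.
rewrite big1 ?addr0 => [|h' /negPf ->]; last by rewrite big1 // => u' _; rewrite mul0r.
exact.
Qed.

Lemma Qto_go_compressed (i : player G) (t : nat) : (t < horizon G)%N ->
  exists q : Ks C t i -> Us G t i -> R,
    (forall c u, `|q c u| <= (horizon G)%:R) /\
    forall (h : Hist (G := G) i t) u, Pr_hu g h u != 0 ->
      Qto_go g h u = q (Defs.comp C h) u.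
Proof.
move=> tT.
have tk (k : 'I_(horizon G - t)) : (t + k < horizon G)%N by have := ltn_ord k; lia.
pose e k := projT1 (cid (ER_on_compressed i (tk k))).
have eP k := projT2 (cid (ER_on_compressed i (tk k))).
exists (fun c u => \sum_k e k c u); split=> [c u|h u Pr0].
  apply: le_trans (ler_norm_sum _ _ _) _.
  apply: le_trans (_ : \sum_(k < horizon G - t) 1 <= _).
    by apply: ler_sum => k _; apply: (eP k).1.
  by rewrite sumr_const card_ord ler_nat leq_subr.
rewrite /Qto_go; apply: (mulIf Pr0); rewrite divfK // mulr_suml.
by apply: eq_bigr => k _; rewrite mulrC; apply: (eP k).2.
Qed.

End MSIvalues.
End GameValues.

(** * Logit equilibria *)

Section Continuity.
Variables (R : realType) (G : game R).
Variables (gn : nat -> profile G) (g : profile G).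
Hypothesis gn_cvg : forall t i (h : Hist (G := G) i t) u,
  @gn n t i h u @[n --> \oo] --> @g t i h u.

Lemma cvgn_fwd (t : nat) (mn : nat -> Traj G t -> R) (m : Traj G t -> R) om :
  (forall o, mn n o @[n --> \oo] --> m o) ->
  fwd (gn n) (mn n) om @[n --> \oo] --> fwd g m om.
Proof.
move=> mn_cvg; rewrite /fwd; apply: cvgM.
  by apply: cvgM; [exact: mn_cvg | exact: cvg_cst].
by apply: cvgn_prod => j _; apply: gn_cvg.
Qed.

Lemma cvgn_prob (t : nat) (om : Traj G t) : prob (gn n) om @[n --> \oo] --> prob g om.
Proof.
elim: t om => [|t IH] om /=; first exact: cvg_cst.
exact: (cvgn_fwd (mn := fun n => @prob R G (gn n) t)).
Qed.

Lemma cvgn_prob_on i (t : nat) (h : Hist (G := G) i t) u om :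
  prob_on (gn n) h u om @[n --> \oo] --> prob_on g h u om.
Proof. by apply: cvgM; [exact: cvgn_prob | exact: cvg_cst]. Qed.

Lemma cvgn_ER_on i (t : nat) (h : Hist (G := G) i t) u k :
  ER_on (gn n) h u k @[n --> \oo] --> ER_on g h u k.
Proof.
apply: cvgn_sum => om _; apply: cvgM; last exact: cvg_cst.
elim: k om => [|k IH] om /=; first exact: cvgn_prob_on.
exact: (cvgn_fwd (mn := fun n => fwdk R G (gn n) t.+1 k (prob_on (gn n) h u))).
Qed.

(** Where the limit probability is positive, division is continuous. Elsewhere full mixing makes
    [Pr_hu] vanish along the whole sequence, and all quotients are 0 since 0 has inverse 0. *)
Lemma cvgn_Qto_go i (t : nat) (h : Hist (G := G) i t) u :
  (forall n, fully_mixed (gn n)) -> fully_mixed g -> (t < horizon G)%N ->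
  Qto_go (gn n) h u @[n --> \oo] --> Qto_go g h u.
Proof.
move=> mgn mg tT; rewrite /Qto_go.
have [Pr0|Pr0] := eqVneq (Pr_hu g h u) 0.
  have Prn0 n : Pr_hu (gn n) h u = 0.
    apply/eqP; rewrite Pr_hu_support // (reach_support h (mgn n) mg (ltnW tT)).
    by rewrite -(Pr_hu_support h u mg tT) Pr0.
  rewrite Pr0 invr0 mulr0; under eq_cvg do rewrite Prn0 invr0 mulr0.
  exact: cvg_cst.
apply: cvgM; first by apply: cvgn_sum => k _; apply: cvgn_ER_on.
by apply: cvgV => //; apply: cvgn_sum => om _; apply: cvgn_prob_on.
Qed.
End Continuity.

(** * Fixed points of perturbed logit responses *)

Section Logit.
Variables (R : realType) (G : game R) (C : compression G).
Hypothesis U_inhab : forall t, (t < horizon G)%N -> forall i, exists u : Us G t i, True.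

(** Indexes the action probabilities of a [K]-based profile before the horizon; with one extra point
    these are the vertices of the simplex for Brouwer's theorem. *)
Definition decision : finType :=
  {t : 'I_(horizon G) & {i : player G & (Ks C t i * Us G t i)%type}}.

Definition decision_of t (tT : (t < horizon G)%N) i (c : Ks C t i) (u : Us G t i) : decision :=
  Tagged (fun t : 'I_(horizon G) => {i : player G & (Ks C t i * Us G t i)%type})
    (i := Ordinal tT) (Tagged (fun i => (Ks C t i * Us G t i)%type) (c, u)).

(** The value 0 past the horizon keeps the profile defined, and convergent, at every time. *)
Definition coord (x : unit + decision -> R) t i (c : Ks C t i) (u : Us G t i) : R :=
  match @idP (t < horizon G)%N with
  | ReflectT tT => x (inr (decision_of tT c u))
  | ReflectF _ => 0
  end.

Lemma coordE x t (tT : (t < horizon G)%N) i (c : Ks C t i) (u : Us G t i) :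
  coord x c u = x (inr (decision_of tT c u)).
Proof. by rewrite /coord; case: {-}_ / idP => // tT'; rewrite (bool_irrelevance tT' tT). Qed.

Lemma coord_ge0 x t i (c : Ks C t i) (u : Us G t i) :
  is_dist x -> 0 <= coord x c u.
Proof. by move=> [x0 _]; rewrite /coord; case: {-}_ / idP. Qed.

Lemma cvgn_coord (xn : nat -> unit + decision -> R) (x : unit + decision -> R) t i (c : Ks C t i) (u : Us G t i) :
  (forall j, xn n j @[n --> \oo] --> x j) ->
  coord (xn n) c u @[n --> \oo] --> coord x c u.
Proof. by move=> H; rewrite /coord; case: {-}_ / idP => // _; exact: cvg_cst. Qed.

Section Smoothing.
Variable eps : R.
Hypothesis eps_gt0 : 0 < eps.

(** Adding [eps] before normalizing gives full mixing even where all coordinates of an information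
    set vanish. *)
Definition smoothed x : Kprofile C := fun t i c u =>
  (coord x c u + eps) / (\sum_(u' : Us G t i) (coord x c u' + eps)).

Lemma smoothed_denom_gt0 x t i (c : Ks C t i) (u : Us G t i) : is_dist x ->
  0 < \sum_(u' : Us G t i) (coord x c u' + eps).
Proof.
move=> xd; rewrite (bigD1 u) //= ltr_wpDr //.
  by apply: sumr_ge0 => u' _; rewrite addr_ge0 ?coord_ge0 // ltW.
by rewrite ltr_wpDl // coord_ge0.
Qed.

Lemma smoothed_gt0 x t i (c : Ks C t i) (u : Us G t i) :
  is_dist x -> 0 < smoothed x c u.
Proof.
move=> xd; rewrite divr_gt0 ?(smoothed_denom_gt0 _ u) //.
by rewrite ltr_wpDl // coord_ge0.
Qed.

Lemma smoothed_valid x : is_dist x -> valid_Kprofile (smoothed x).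
Proof.
move=> xd t tT i c; split=> [u|]; first by rewrite ltW // smoothed_gt0.
rewrite -mulr_suml divff //; have [u _] := U_inhab tT i.
by rewrite gt_eqF // (smoothed_denom_gt0 _ u).
Qed.

Lemma smoothed_mixed x : is_dist x -> fully_mixed (Kbased (smoothed x)).
Proof.
move=> xd; split=> [|t tT i h u]; last exact: smoothed_gt0.
by move=> t tT i h; apply: smoothed_valid.
Qed.

Lemma cvgn_smoothed (xn : nat -> unit + decision -> R) (x : unit + decision -> R) t i (c : Ks C t i) (u : Us G t i) :
  is_dist x -> (forall j, xn n j @[n --> \oo] --> x j) ->
  smoothed (xn n) c u @[n --> \oo] --> smoothed x c u.
Proof.
move=> xd H.
have H' u' : coord (xn n) c u' + eps @[n --> \oo] --> coord x c u' + eps.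
  by apply: cvgD; [exact: cvgn_coord | exact: cvg_cst].
apply: cvgM; first exact: H'.
apply: cvgV; first by rewrite gt_eqF // (smoothed_denom_gt0 _ u).
by apply: cvgn_sum => u' _.
Qed.
End Smoothing.

(* The continuation value is summed over all histories with compression [c];
   under MSI the reachable ones agree and the unreachable ones contribute 0,
   so this is a positive multiple of the common value. *)
Definition total_value (rho : Kprofile C) t i (c : Ks C t i) (u : Us G t i) : R :=
  \sum_(h : Hist (G := G) i t | Defs.comp C h == c) Qto_go (Kbased rho) h u.

Definition logit (lambda : R) (rho : Kprofile C) t i (c : Ks C t i) (u : Us G t i) : R :=
  expR (lambda * total_value rho c u) /
  \sum_(u' : Us G t i) expR (lambda * total_value rho c u').

Lemma logit_denom_gt0 lambda rho t i (c : Ks C t i) (u : Us G t i) :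
  0 < \sum_(u' : Us G t i) expR (lambda * total_value rho c u').
Proof.
rewrite (bigD1 u) //= ltr_wpDr ?expR_gt0 //.
by apply: sumr_ge0 => u' _; apply: expR_ge0.
Qed.

Lemma logit_dist lambda rho t i (c : Ks C t i) : (t < horizon G)%N ->
  is_dist (logit lambda rho c).
Proof.
move=> tT; split=> [u|]; first by rewrite divr_ge0 ?expR_ge0 ?ltW ?(logit_denom_gt0 _ _ _ u).
rewrite -mulr_suml divff //; have [u _] := U_inhab tT i.
by rewrite gt_eqF // (logit_denom_gt0 _ _ _ u).
Qed.

(** Only the term of [u'] is kept in the denominator. *)
Lemma logit_le lambda rho t i (c : Ks C t i) (u u' : Us G t i) :
  logit lambda rho c u <= expR (lambda * (total_value rho c u - total_value rho c u')).
Proof.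
rewrite mulrBr expRD expRN ler_pM2l ?expR_gt0 // lef_pV2 ?posrE ?expR_gt0 //.
  rewrite (bigD1 u') //= lerDl; apply: sumr_ge0 => v _; exact: expR_ge0.
exact: logit_denom_gt0.
Qed.

Definition num_info_sets : R :=
  \sum_(t < horizon G) \sum_(i : player G) \sum_(c : Ks C t i) 1.

Lemma num_info_sets_gt0 : 0 < 1 + num_info_sets.
Proof. by rewrite ltr_pwDl // sumr_ge0 // => t _; apply: sumr_ge0 => i _; apply: sumr_ge0. Qed.

(* Each information set receives mass [1 / (1 + num_info_sets)], and the extra
   point [inl tt] the rest, so that the product of simplices of the K-based
   profiles sits inside a single simplex. *)
Definition response lambda eps (x : unit + decision -> R) (j : unit + decision) : R :=
  (if j is inr (existT t (existT i (c, u))) then logit lambda (smoothed eps x) c u else 1)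
    / (1 + num_info_sets).

Lemma response_dist lambda eps x : is_dist (response lambda eps x).
Proof.
have N0 := num_info_sets_gt0.
split=> [[[]|[t [i [c u]]]]|].
- by rewrite divr_ge0 ?ltW.
- by rewrite divr_ge0 ?(ltW N0) // (logit_dist _ _ _ (ltn_ord t)).1.
rewrite /response -mulr_suml big_sumType /= big_const card_unit /= addr0.
suff -> : \sum_(j : decision) (let: existT t (existT i (c, u)) := j in
    logit lambda (smoothed eps x) c u) = num_info_sets by rewrite divff ?gt_eqF.
rewrite /num_info_sets.
pose F (t : 'I_(horizon G)) (y : {i : player G & (Ks C t i * Us G t i)%type}) :=
  let: existT i (c, u) := y in logit lambda (smoothed eps x) c u.
transitivity (\sum_(j : decision) F (tag j) (tagged j)).
  by apply: eq_bigr => -[t [i [c u]]].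
rewrite -(sig_big_dep xpredT (fun _ _ => true) F); apply: eq_bigr => t _.
pose F' i (y : Ks C t i * Us G t i) := logit lambda (smoothed eps x) y.1 y.2.
transitivity (\sum_(y : {i : player G & (Ks C t i * Us G t i)%type}) F' (tag y) (tagged y)).
  by apply: eq_bigr => -[i [c u]].
rewrite -(sig_big_dep xpredT (fun _ _ => true) F'); apply: eq_bigr => i _.
rewrite /F' -(pair_bigA _ (fun c u => logit lambda (smoothed eps x) c u)) /=.
by apply: eq_bigr => c _; rewrite (logit_dist _ _ _ (ltn_ord t)).2.
Qed.

Lemma cvgn_response lambda eps (xn : nat -> unit + decision -> R) (x : unit + decision -> R) j : 0 < eps ->
  (forall n, is_dist (xn n)) -> is_dist x -> (forall j, xn n j @[n --> \oo] --> x j) ->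
  response lambda eps (xn n) j @[n --> \oo] --> response lambda eps x j.
Proof.
move=> e0 xnd xd xn_cvg; apply: cvgM; last exact: cvg_cst.
case: j => [[]|[t [i [c u]]]]; first exact: cvg_cst.
have H u' : expR (lambda * total_value (smoothed eps (xn n)) c u') @[n --> \oo] -->
    expR (lambda * total_value (smoothed eps x) c u').
  apply: (cvg_comp _ expR); last exact: continuous_expR.
  apply: cvgM; first exact: cvg_cst.
  apply: cvgn_sum => h _; apply: cvgn_Qto_go.
  - by move=> t' i' h' v; apply: cvgn_smoothed.
  - by move=> n; apply: smoothed_mixed.
  - exact: smoothed_mixed.
  - exact: ltn_ord.
apply: cvgM; first exact: H.
apply: cvgV; first by rewrite gt_eqF // (logit_denom_gt0 _ _ _ u).
by apply: cvgn_sum => u' _; apply: H.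
Qed.

(** At a fixed point of [response], smoothing amounts to adding [eps] to each logit probability and
    dividing by a number at least 1, so [logit_le] holds up to [eps]. *)
Lemma approximate_logit_equilibrium (lambda eps : R) : 0 < eps ->
  exists rho : Kprofile C,
    [/\ valid_Kprofile rho, fully_mixed (Kbased rho) &
      forall t, (t < horizon G)%N -> forall i (c : Ks C t i) (u u' : Us G t i),
        rho t i c u <= expR (lambda * (total_value rho c u - total_value rho c u')) + eps].
Proof.
move=> e0; have N0 := num_info_sets_gt0.
(* The fixed point is a logit response divided by [1 + num_info_sets]; the same factor in [d] lets
   it cancel. *)
pose d := eps / (1 + num_info_sets).
have d0 : 0 < d by rewrite divr_gt0.
have [x [xd xfix]] := brouwer_simplex (inl tt)
  (fun x (_ : is_dist x) => response_dist lambda d x)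
  (fun xn x xnd xd H j => @cvgn_response lambda d xn x j d0 xnd xd H).
exists (smoothed d x); split; [exact: smoothed_valid | exact: smoothed_mixed |].
move=> t tT i c u u'.
have cE v : coord x c v = logit lambda (smoothed d x) c v / (1 + num_info_sets).
  by rewrite (coordE _ tT) -[LHS]xfix.
apply: le_trans (_ : logit lambda (smoothed d x) c u + eps <= _); last first.
  by rewrite lerD2r logit_le.
have -> : smoothed d x c u = (logit lambda (smoothed d x) c u + eps) /
    (1 + \sum_(v : Us G t i) eps).
  rewrite {1}/smoothed cE -mulrDl.
  under eq_bigr do rewrite cE -mulrDl.
  rewrite -mulr_suml big_split /= (logit_dist _ _ _ tT).2.
  rewrite invfM invrK mulrACA mulVf ?mulr1 // gt_eqF //.
rewrite ler_pdivrMr; last by rewrite ltr_pwDl // sumr_ge0 // => v _; apply: ltW.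
rewrite ler_peMr // ?lerDl; last by rewrite sumr_ge0 // => v _; apply: ltW.
by rewrite addr_ge0 ?(ltW e0) // (logit_dist _ _ _ tT).1.
Qed.
End Logit.

(** * The limit *)

Section Limit.
Variables (R : realType) (G : game R) (C : compression G).
Hypothesis msi : MSI C.

Lemma Qto_go_bounded (rho : Kprofile C) (t : nat) i (h : Hist (G := G) i t) u :
  valid_Kprofile rho -> (t < horizon G)%N ->
  `|Qto_go (Kbased rho) h u| <= (horizon G)%:R.
Proof.
move=> vrho tT; have [q [qb Hq]] := Qto_go_compressed vrho msi i tT.
have [Pr0|Pr0] := eqVneq (Pr_hu (Kbased rho) h u) 0; last by rewrite Hq.
by rewrite /Qto_go Pr0 invr0 mulr0 normr0.
Qed.

(** Reachable histories compressed like [h] share its positive gap by MSI, and unreachable ones have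
    gap 0, so the total gap is at least the term of [h]. *)
Lemma total_value_gap (rho : Kprofile C) (t : nat) i (h : Hist (G := G) i t) u u' :
  valid_Kprofile rho -> fully_mixed (Kbased rho) -> (t < horizon G)%N ->
  0 < Qto_go (Kbased rho) h u' - Qto_go (Kbased rho) h u ->
  Qto_go (Kbased rho) h u' - Qto_go (Kbased rho) h u <=
  total_value rho (Defs.comp C h) u' - total_value rho (Defs.comp C h) u.
Proof.
move=> vrho mrho tT gap; have [q [_ Hq]] := Qto_go_compressed vrho msi i tT.
have diffE h' : Defs.comp C h' = Defs.comp C h ->
    Qto_go (Kbased rho) h' u' - Qto_go (Kbased rho) h' u =
    if reach (Kbased rho) h' == 0 then 0
    else q (Defs.comp C h) u' - q (Defs.comp C h) u.
  move=> Eh; have [r0|r0] := eqVneq (reach (Kbased rho) h') 0.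
    have P0 v : Pr_hu (Kbased rho) h' v = 0.
      by apply/eqP; rewrite Pr_hu_support // r0.
    by rewrite /Qto_go !P0 invr0 !mulr0 subrr.
  by rewrite !Hq ?Eh // Pr_hu_support.
have Eq : Qto_go (Kbased rho) h u' - Qto_go (Kbased rho) h u =
    q (Defs.comp C h) u' - q (Defs.comp C h) u.
  by move: gap; rewrite diffE //; case: ifP => //; rewrite ltxx.
rewrite -sumrB (bigD1 h) //= lerDl; apply: sumr_ge0 => h' /andP[/eqP Eh _].
by rewrite diffE //; case: ifP => // _; rewrite -Eq ltW.
Qed.

(** The value gap eventually exceeds half its limit, and the bound on the probability then decays
    like [1 / (phi n).+1]. *)
Lemma dominated_action_vanishes (rho : nat -> Kprofile C) (phi : nat -> nat) (p : R) (t : nat) i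
    (h : Hist (G := G) i t) u u' (l l' : R) :
  (t < horizon G)%N ->
  (forall n, valid_Kprofile (rho n)) -> (forall n, fully_mixed (Kbased (rho n))) ->
  (forall n, (n <= phi n)%N) ->
  (forall n, rho n t i (Defs.comp C h) u <=
    expR ((phi n)%:R * (total_value (rho n) (Defs.comp C h) u -
                       total_value (rho n) (Defs.comp C h) u')) + (phi n).+1%:R^-1) ->
  rho n t i (Defs.comp C h) u @[n --> \oo] --> p ->
  Qto_go (Kbased (rho n)) h u @[n --> \oo] --> l ->
  Qto_go (Kbased (rho n)) h u' @[n --> \oo] --> l' ->
  l < l' -> p <= 0.
Proof.
move=> tT vrho mrho Hphi bound p_cvg l_cvg l'_cvg ll'.
pose d := (l' - l) / 2; have d0 : 0 < d by rewrite divr_gt0 // subr_gt0.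
(* Of this constant, [1 + d^-1] bounds the exponential and 1 the perturbation. *)
have K_cvg : (2 + d^-1) * (phi n).+1%:R^-1 @[n --> \oo] --> ((2 + d^-1) * 0 : R).
  apply: cvgM; first exact: cvg_cst.
  exact: (cvgn_subseq Hphi (@cvg_harmonic R)).
rewrite mulr0 in K_cvg; apply: (ler_cvg_to p_cvg K_cvg).
have gap_cvg : Qto_go (Kbased (rho n)) h u' - Qto_go (Kbased (rho n)) h u
    @[n --> \oo] --> l' - l by apply: cvgB.
have gap_ge : \forall n \near \oo,
    d < Qto_go (Kbased (rho n)) h u' - Qto_go (Kbased (rho n)) h u.
  by apply: (cvgr_gt (l' - l)) => //; rewrite /d; lra.
near=> n.
have gap : d < Qto_go (Kbased (rho n)) h u' - Qto_go (Kbased (rho n)) h u by near: n.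
have := total_value_gap (vrho n) (mrho n) tT (lt_trans d0 gap).
set Du := _ - total_value _ _ _ => HD.
have dD : d <= Du by apply: le_trans (ltW gap) HD.
apply: le_trans (bound n) _; rewrite -[_ - _]opprB -/Du mulrN expRN.
set m := phi n; set mR : R := m%:R.
have m0 : 0 <= mR by rewrite ler0n.
have mS : m.+1%:R = 1 + mR :> R by rewrite /mR -natr1 addrC.
rewrite mS.
have e_ge : 1 + mR * d <= expR (mR * Du).
  apply: le_trans (expR_ge1Dx _); rewrite lerD2l; exact: ler_wpM2l.
have : (expR (mR * Du))^-1 <= (1 + d^-1) * (1 + mR)^-1.
  apply: le_trans (_ : (1 + mR * d)^-1 <= _).
    by rewrite lef_pV2 ?posrE ?expR_gt0 // ltr_pwDl // mulr_ge0 // ltW.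
  have p1 : 0 < 1 + mR * d by rewrite ltr_pwDl // mulr_ge0 // ltW.
  have p2 : 0 < 1 + mR by rewrite ltr_pwDl.
  rewrite ler_pdivlMr // mulrC ler_pdivrMr //.
  have -> : (1 + d^-1) * (1 + mR * d) = 1 + mR * d + d^-1 + mR * (d^-1 * d) by ring.
  rewrite mulVf ?gt_eqF // mulr1.
  have h1 : 0 <= mR * d by rewrite mulr_ge0 // ltW.
  have h2 : 0 < d^-1 by rewrite invr_gt0.
  lra.
set a := (expR _)^-1; set b := (1 + mR)^-1 => ab.
have -> : (2 + d^-1) * b = (1 + d^-1) * b + b by ring.
by rewrite lerD2r.
Unshelve. all: by end_near.
Qed.

End Limit.

Theorem theorem3 (R : realType) (G : game R) (C : compression G) :
  (forall t, (t < horizon G)%N -> forall i, exists u : Us G t i, True) ->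
  MSI C ->
  exists (rho : Kprofile C) (Q : Qfun G),
    valid_Kprofile rho /\ sequential_equilibrium (Kbased rho) Q.
Proof.
move=> U_inhab msi.
have eps0 n : 0 < n.+1%:R^-1 :> R by rewrite invr_gt0 ltr0n.
(* The logit parameter [n] grows while the perturbation [1 / n.+1] fades. *)
have approx n := approximate_logit_equilibrium C U_inhab n%:R (eps0 n).
pose rhon n := projT1 (cid (approx n)).
have rhon_valid n : valid_Kprofile (rhon n).
  by have [H _ _] := projT2 (cid (approx n)).
have rhon_mixed n : fully_mixed (Kbased (rhon n)).
  by have [_ H _] := projT2 (cid (approx n)).
have rhon_logit n : forall t, (t < horizon G)%N ->
    forall i (c : Ks C t i) (u u' : Us G t i), rhon n t i c u <=
    expR (n%:R * (total_value (rhon n) c u - total_value (rhon n) c u')) + n.+1%:R^-1.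
  by have [_ _ H] := projT2 (cid (approx n)).
pose J1 := {t : 'I_(horizon G) & {i : player G & (Ks C t i * Us G t i)%type}}.
pose J2 := {t : 'I_(horizon G) & {i : player G & (Hist (G := G) i t * Us G t i)%type}}.
(* Probabilities and values form one bounded vector, so one subsequence serves both. *)
pose x n (j : (J1 + J2)%type) : R := match j with
  | inl (existT t (existT i (c, u))) => rhon n t i c u
  | inr (existT t (existT i (h, u))) => Qto_go (Kbased (rhon n)) h u
  end.
have [|phi [Hphi x_cvg]] := @bolzano_weierstrass_fin R (J1 + J2)%type x (1 + (horizon G)%:R).
  move=> n [[t [i [c u]]]|[t [i [h u]]]] /=; last first.
    by apply: le_trans (Qto_go_bounded msi _ _ (rhon_valid n) (ltn_ord t)) _; rewrite lerDr.
  have [p0 p1] := rhon_valid n t (ltn_ord t) i c.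
  rewrite ger0_norm //; apply: le_trans (_ : 1 <= _); last by rewrite lerDl.
  by rewrite -p1 (bigD1 u) //= lerDl sumr_ge0.
pose rho : Kprofile C := fun t i c u => lim (rhon (phi n) t i c u @[n --> \oo]).
pose Q : Qfun G := fun t i h u => lim (Qto_go (Kbased (rhon (phi n))) h u @[n --> \oo]).
have rho_cvg t (tT : (t < horizon G)%N) i c u :
    rhon (phi n) t i c u @[n --> \oo] --> rho t i c u.
  exact: (x_cvg (inl (existT _ (Ordinal tT) (existT _ i (c, u))))).
have Q_cvg t (tT : (t < horizon G)%N) i h u :
    Qto_go (Kbased (rhon (phi n))) h u @[n --> \oo] --> Q t i h u.
  exact: (x_cvg (inr (existT _ (Ordinal tT) (existT _ i (h, u))))).
have rho_valid : valid_Kprofile rho.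
  move=> t tT i c; split=> [u|].
    apply: limr_ge; first exact: (rho_cvg t tT i c u).
    by near=> n; apply: (rhon_valid _ t tT i c).1.
  have H : \sum_u rhon (phi n) t i c u @[n --> \oo] --> \sum_u rho t i c u.
    by apply: cvgn_sum => u _; apply: rho_cvg.
  have H1 : \sum_u rhon (phi n) t i c u @[n --> \oo] --> (1 : R).
    by under eq_cvg do rewrite (rhon_valid _ t tT i c).2; exact: cvg_cst.
  exact: (cvg_unique _ H H1).
exists rho, Q; split=> //; split; first by move=> t tT i h; apply: rho_valid.
split.
  (* A strictly better [u'] would force the limit probability of [u] down to 0. *)
  move=> t tT i h u rho_pos u'; rewrite leNgt; apply/negP => Qlt.
  have := @dominated_action_vanishes R G C msi (fun n => rhon (phi n)) phi
    (rho t i (Defs.comp C h) u) t i h u u' (Q t i h u) (Q t i h u') tT.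
  rewrite leNgt rho_pos => H; suff: false by []; apply: H => //.
  - by move=> n; apply: rhon_logit.
  - exact: rho_cvg.
  - exact: Q_cvg.
  - exact: Q_cvg.
(* The fully mixed approximants witness consistency, [Q] being the limit of their continuation
   values. *)
exists (fun n => Kbased (rhon (phi n))), (fun n t i h u => Qto_go (Kbased (rhon (phi n))) h u).
split; first by move=> n; apply: rhon_mixed.
split; first by [].
split=> t tT i h u; last exact: Q_cvg.
exact: rho_cvg.
Unshelve. all: by end_near.
Qed.
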